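(* Let $G=G_1\oplus G_2$ be a finitely generated abelian group with $G_1\cong\mathbb{Z}^m$ and $G_2\cong\bigoplus_{i=1}^l\mathbb{Z}_{q_i}$, let $S$ be a finite symmetric generating set of $G$, and let $d\ge 0$ be real. Then $$\dim HM^d(G,S)=\dim H^d(G,S)=\dim HP^{[d]}(\mathbb{R}^m),$$ where $[d]$ denotes the largest integer not exceeding $d$.
   Context: Group: $m\ge 1$ and $l\ge 0$ are integers ($l=0$ being the torsion-free case), and each $q_i=p_i^{a_i}$ is a prime power. Generating sets: a finite symmetric generating set is a finite list $S=(s_1,\dots,s_{2r})$ of elements generating $G$ with $s_{i+r}=-s_i$ for $1\le i\le r$; repetitions are allowed and $0\in S$ is allowed. The Cayley graph $(G,S)$ has vertex set $G$ and $x\sim y$ iff $y-x\in S$; sums over $y\sim x$ are taken with multiplicity, i.e. $\sum_{y\sim x}h(y)=\sum_{i=1}^{2r}h(x+s_i)$. $d^S$ is the word metric (length of a shortest path in the Cayley graph). Laplacian: $L^Su(x)=\sum_{y\sim x}(u(y)-u(x))$. Function spaces: for a fixed base point $p\in G$, $$H^d(G,S)=\{u:G\to\mathbb{R}\mid L^Su=0 \text{ on } G,\ \exists C:\ |u(x)|\le C(d^S(p,x)+1)^d\ \forall x\in G\},$$ $$HM^d(G,S)=\mathrm{Span}\{u:G\to\mathbb{R}\mid L^Su=0 \text{ on } G,\ \exists C:\ u(x)\ge -C(d^S(p,x)+1)^d\ \forall x\in G\}$$ (real linear span). For an integer $k\ge 0$, $HP^k(\mathbb{R}^m)$ is the real vector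 space of harmonic polynomials on $\mathbb{R}^m$ ($\Delta u=0$) of degree at most $k$. It is well known that $\dim HP^k(\mathbb{R}^m)=\binom{m+k-1}{k}+\binom{m+k-2}{k-1}$ for $k\ge 1$, and $\dim HP^0(\mathbb{R}^m)=1$. *)

(* Defs.v *)
(* The multinomials notations clash with those of MathComp-Analysis, so mpoly
   is imported without them. *)
From HB Require Import structures.
From mathcomp Require Import all_boot all_order all_algebra.
From mathcomp Require Import boolp classical_sets functions reals exp.
From mathcomp Require mpoly.
Import -(notations) mpoly.

Set Implicit Arguments.
Unset Strict Implicit.
Unset Printing Implicit Defensive.
Import Order.TTheory GRing.Theory Num.Theory.
Local Open Scope classical_set_scope.
Local Open Scope ring_scope.

Section Dimension.
Variables (R : realType) (V : lmodType R).

Definition linear_span (A : set V) : set V :=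
  [set v | exists n (c : 'I_n -> R) (f : 'I_n -> V),
    (forall i, A (f i)) /\ v = \sum_(i < n) c i *: f i].

Definition is_basis (A : set V) n (b : 'I_n -> V) : Prop :=
  (forall v, A v <-> exists c : 'I_n -> R, v = \sum_(i < n) c i *: b i) /\
  (forall c : 'I_n -> R, \sum_(i < n) c i *: b i = 0 -> forall i, c i = 0).

(* In particular A is a linear subspace. *)
Definition has_dim (A : set V) (n : nat) : Prop :=
  exists b : 'I_n -> V, is_basis A b.

End Dimension.

Section Cayley.
Variables (G : zmodType) (S : seq G).

Definition cayley : rel G := fun x y => y - x \in S.

Definition joined_in (x y : G) : pred nat := fun n =>
  `[< exists s : seq G, [/\ size s = n, path cayley x s & last x s = y] >].

(* The default value 0 is only taken when x and y are not connected, which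
   cannot happen when S is a symmetric generating set. *)
Definition word_metric (x y : G) : nat :=
  if pselect (exists n, joined_in x y n) is left e then ex_minn e else 0%N.

Variable R : realType.

Definition laplacian (u : G -> R) (x : G) : R :=
  \sum_(s <- S) (u (x + s) - u x).

Definition growth (d : R) (x0 x : G) : R := ((word_metric x0 x)%:R + 1) `^ d.

(* R^o makes G -> R a module over R. *)
Definition H (d : R) (x0 : G) : set (G -> R^o) :=
  [set u | (forall x, laplacian u x = 0) /\
           exists C : R, forall x, `|u x| <= C * growth d x0 x].

Definition HM (d : R) (x0 : G) : set (G -> R^o) :=
  linear_span ([set u | (forall x, laplacian u x = 0) /\
                        exists C : R, forall x, - C * growth d x0 x <= u x]
               : set (G -> R^o)).

End Cayley.

Section HarmonicPolynomials.
Variables (R : realType) (m : nat).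

Definition mpoly_laplacian (u : mpoly m R) : mpoly m R :=
  \sum_(i < m) mderiv i (mderiv i u).

(* mmeasure mdeg (msize) is 1 + total degree, and 0 for the zero polynomial. *)
Definition HP (k : nat) : set (mpoly m R) :=
  [set u | mpoly_laplacian u = 0 /\
           (mmeasure (@mdeg m) u <= k.+1)%N].

End HarmonicPolynomials.

Arguments HP : clear implicits.

(* Main.v *)
(** Write [P] for averaging over one step of the walk on [(G, S)].

    Harnack: if [v >= 0], then [P^n v x] dominates a multinomial probability
    times [v (x + y)].  For [y] of length [E] and [n] of order [E^2] that
    probability is at least a negative power of [E], so a harmonic function
    bounded below by [- C (1 + |x|)^d] has polynomial growth of some degree.

    Gradient: coupling walks started at [x] and [x + s] bounds [u (x + s) - u x]
    by [O(1/J)] times the supremum of [|u|] over a ball of radius [O(J^3)].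
    Iterating and letting [J] grow, sufficiently many differences of a harmonic
    function of polynomial growth vanish: it is a polynomial on [Z^m], and is
    invariant under torsion.

    Degree: if [u] is a harmonic polynomial of exact degree [K > d], then
    [P^n (u^2)] grows like [n^K] and [P^n (u^4)] is [O(n^(2K))]; but [P^n u] is
    constant, so the lower bound on [u] makes [P^n |u|] of order [n^(d/2)] only,
    contradicting [u^2 <= T |u| + u^4 / T^2] with [T] of order [n^(K/2)].

    Hence both spaces consist of the harmonic lattice polynomials of degree at
    most [[d]].  In divided-power coordinates (the basis [binom(x, a)] on [Z^m]
    and [X^a / a!] on [R^m]) the discrete and continuous Laplacians are both of
    the form [c |-> (b |-> sum_g F_g c_(b + g))] with [F_g = 0] for [|g| < 2] and
    [F_(2 e_1) <> 0].  The kernel of any such operator is parametrized by the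
    coefficients whose exponent in the first variable is at most 1. *)

Require Import Defs.
From HB Require Import structures.
From mathcomp Require Import all_boot all_order all_algebra.
From mathcomp Require Import boolp classical_sets functions reals exp.
From mathcomp Require mpoly.
From mathcomp Require Import ring lra zify.
Import -(notations) mpoly.
Set Implicit Arguments.
Unset Strict Implicit.
Unset Printing Implicit Defensive.
Import Order.TTheory GRing.Theory Num.Theory.
Local Open Scope classical_set_scope.
Local Open Scope ring_scope.

(** * Finite differences *)

Section Differences.
Variables (R : realType) (G : zmodType).
Implicit Types (f h : G -> R) (g x : G) (n : nat).

Definition diff g f : G -> R := fun x => f (x + g) - f x.

(* For functions on Z^m, [deg_lt n f] says that [f] is a polynomial of degree
   less than [n]. *)
Fixpoint deg_lt n f : Prop :=
  if n is k.+1 then forall g, deg_lt k (diff g f) else forall x, f x = 0.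

Lemma deg_ltS n f : deg_lt n f -> deg_lt n.+1 f.
Proof.
elim: n f => [|n IHn] f /= f0; last by move=> g; apply: IHn; apply: f0.
by move=> g x; rewrite /diff !f0 subrr.
Qed.

Lemma deg_lt_le n k f : (n <= k)%N -> deg_lt n f -> deg_lt k f.
Proof.
move=> /subnK <-; elim: (k - n)%N => [|i IHi] // nf.
by rewrite addSn; apply/deg_ltS/IHi.
Qed.

Lemma deg_lt_lin n a f h :
  deg_lt n f -> deg_lt n h -> deg_lt n (fun x => a * f x + h x).
Proof.
elim: n f h => [|n IHn] f h /= nf nh; first by move=> x; rewrite nf nh mulr0 addr0.
move=> g; have -> : diff g (fun x => a * f x + h x)
  = (fun x => a * diff g f x + diff g h x) by apply: funext => x; rewrite /diff; ring.
exact: IHn.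
Qed.

Lemma deg_lt0 n : deg_lt n (fun=> 0).
Proof. exact: (@deg_lt_le 0). Qed.

Lemma deg_lt_cst n c : deg_lt n.+1 (fun=> c).
Proof. by apply: (@deg_lt_le 1) => // g x; rewrite /diff subrr. Qed.

Lemma deg_lt_scale n a f : deg_lt n f -> deg_lt n (fun x => a * f x).
Proof.
move=> nf; have -> : (fun x => a * f x) = (fun x => a * f x + 0).
  by apply: funext => x; rewrite addr0.
by apply: deg_lt_lin => //; apply: deg_lt0.
Qed.

Lemma deg_lt_add n f h : deg_lt n f -> deg_lt n h -> deg_lt n (fun x => f x + h x).
Proof.
move=> nf nh; have -> : (fun x => f x + h x) = (fun x => 1 * f x + h x).
  by apply: funext => x; rewrite mul1r.
exact: deg_lt_lin.
Qed.

Lemma deg_lt_sum (I : Type) n (r : seq I) (F : I -> G -> R) :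
  (forall i, deg_lt n (F i)) -> deg_lt n (fun x => \sum_(i <- r) F i x).
Proof.
move=> nF; elim: r => [|i r IHr].
  have -> : (fun x => \sum_(i <- [::]) F i x) = (fun=> 0).
    by apply: funext => x; rewrite big_nil.
  exact: deg_lt0.
have -> : (fun x => \sum_(j <- i :: r) F j x)
    = (fun x => F i x + \sum_(j <- r) F j x).
  by apply: funext => x; rewrite big_cons.
exact: deg_lt_add.
Qed.

Lemma deg_lt_shift n f g : deg_lt n f -> deg_lt n (fun x => f (x + g)).
Proof.
elim: n f => [|n IHn] f /= nf; first by move=> x; rewrite nf.
move=> k; have -> : diff k (fun x => f (x + g)) = (fun x => diff k f (x + g)).
  by apply: funext => x; rewrite /diff addrAC.
exact: IHn.
Qed.

(** Induction on [i + j], since each Leibniz term lowers only one of the two degrees. The truncation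
    in [.-1] is harmless: when [i] and [j] are both 0 the product is zero. *)
Lemma deg_ltM i j f h :
  deg_lt i f -> deg_lt j h -> deg_lt (i + j).-1 (fun x => f x * h x).
Proof.
elim: {i j}(i + j)%N {-2}i {-2}j (leqnn (i + j)) f h => [|n IHn] i j leij f h.
  move: leij; rewrite leqn0 addn_eq0 => /andP[/eqP-> /eqP->] /= f0 _ x.
  by rewrite f0 mul0r.
case: i leij => [|i] leij fi hj.
  have -> : (fun x => f x * h x) = (fun=> 0) by apply: funext => x; rewrite fi mul0r.
  exact: deg_lt0.
case: j leij hj => [|j] leij hj.
  have -> : (fun x => f x * h x) = (fun=> 0) by apply: funext => x; rewrite hj mulr0.
  exact: deg_lt0.
rewrite addnS /= => g.
have -> : diff g (fun x => f x * h x)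
    = (fun x => diff g f x * h (x + g) + f x * diff g h x).
  by apply: funext => x; rewrite /diff; ring.
apply: deg_lt_add.
  rewrite -[(i + j)%N]/((i + j).+1.-1) -addnS.
  by apply: IHn; [lia | exact: fi | exact: deg_lt_shift].
rewrite -[(i + j)%N]/((i.+1 + j).-1).
by apply: IHn; [lia | exact: fi | exact: hj].
Qed.

Lemma deg_ltX j f : deg_lt 3 f -> deg_lt j.*2.+1 (fun x => f x ^+ j).
Proof.
move=> f3; elim: j => [|j IHj].
  exact: (@deg_lt_cst 0 1).
have -> : (fun x => f x ^+ j.+1) = (fun x => f x * f x ^+ j).
  by apply: funext => x; rewrite exprS.
by have := deg_ltM f3 IHj; rewrite doubleS.
Qed.

Lemma diff_additive g1 g2 f x :
  diff (g1 + g2) f x = diff g1 f (x + g2) + diff g2 f x.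
Proof. by rewrite /diff -!addrA [g2 + g1]addrC; ring. Qed.

Lemma diff_mulrn g f x k :
  (forall y, diff g (diff g f) y = 0) -> f (x + g *+ k) = f x + diff g f x *+ k.
Proof.
move=> ddf; have cst y j : diff g f (y + g *+ j) = diff g f y.
  elim: j => [|j IHj]; first by rewrite addr0.
  by have /eqP := ddf (y + g *+ j); rewrite subr_eq0 mulrSr addrA IHj => /eqP.
elim: k => [|k IHk]; first by rewrite addr0 addr0.
have := cst x k; rewrite /diff -addrA -mulrSr => /eqP.
by rewrite subr_eq => /eqP ->; rewrite IHk mulrS addrCA addrA.
Qed.

(* Along a torsion element a polynomial function is periodic, hence constant. *)
Lemma diff_torsion n f t q : (0 < q)%N -> t *+ q = 0 -> deg_lt n f ->
  forall x, diff t f x = 0.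
Proof.
move=> q0 tq; elim: n f => [|n IHn] f /= nf x; first by rewrite /diff !nf subrr.
(* By induction [diff t f] is constant along [t], so [q] steps add [q] times [diff t f x] and yet
   return to [x]. *)
have := diff_mulrn x q (IHn _ (nf t)).
rewrite tq addr0 => /eqP; rewrite -subr_eq0 opprD addrA subrr add0r oppr_eq0.
by rewrite -mulr_natr mulf_eq0 pnatr_eq0 (gtn_eqF q0) orbF => /eqP.
Qed.

End Differences.

(** * The random walk *)

Section Walk.
Variables (R : realType) (G : zmodType) (r : nat) (S : (r + r).-tuple G).
Implicit Types (f u v : G -> R) (x y : G) (w : seq 'I_(r + r)).

Local Notation N := (r + r)%N.

Hypothesis r_gt0 : (0 < r)%N.
Hypothesis S_sym : forall i : 'I_r, tnth S (rshift r i) = - tnth S (lshift r i).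

(** Words list indices rather than group elements, so a repeated generator counts with its
    multiplicity. *)
Definition wsum w : G := \sum_(i <- w) tnth S i.

Hypothesis S_gen : forall x, exists w, x = wsum w.

Definition avg f : G -> R := fun x => N%:R^-1 * \sum_(i < N) f (x + tnth S i).

Definition harmonic f := forall x, avg f x = f x.

Let N_gt0 : 0 < N%:R :> R.
Proof. by rewrite ltr0n addn_gt0 r_gt0. Qed.

Lemma wsum_cons i w : wsum (i :: w) = tnth S i + wsum w.
Proof. by rewrite /wsum big_cons. Qed.

Lemma wsum_cat w1 w2 : wsum (w1 ++ w2) = wsum w1 + wsum w2.
Proof. by rewrite /wsum big_cat. Qed.

Lemma sum_sym (V : zmodType) (F : G -> V) :
  \sum_(i < N) F (- tnth S i) = \sum_(i < N) F (tnth S i).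
Proof.
rewrite !big_split_ord /= addrC; congr (_ + _); apply: eq_bigr => i _.
  by rewrite S_sym opprK.
by rewrite S_sym.
Qed.

Lemma sum_S0 : \sum_(i < N) tnth S i = 0.
Proof.
rewrite big_split_ord /= -big_split big1 //= => i _.
by rewrite S_sym subrr.
Qed.

Lemma avg_lin a f h : avg (fun x => a * f x + h x) = (fun x => a * avg f x + avg h x).
Proof. by apply: funext => x; rewrite /avg big_split /= -mulr_sumr; ring. Qed.

Lemma iter_avg_lin n a f h : iter n avg (fun x => a * f x + h x)
  = (fun x => a * iter n avg f x + iter n avg h x).
Proof. by elim: n => [|n IHn] //; rewrite !iterS IHn avg_lin. Qed.

Lemma avg_le f h x : (forall y, f y <= h y) -> avg f x <= avg h x.
Proof. by move=> fh; rewrite ler_pM2l ?invr_gt0 //; apply: ler_sum. Qed.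

Lemma iter_avg_le n f h : (forall y, f y <= h y) ->
  forall x, iter n avg f x <= iter n avg h x.
Proof. by move=> fh; elim: n => [|n IHn] //= x; apply: avg_le. Qed.

Lemma avg_cst c : avg (fun=> c) = (fun=> c).
Proof.
apply: funext => x; rewrite /avg sumr_const card_ord -[c *+ _]mulr_natl mulKf //.
exact: lt0r_neq0.
Qed.

Lemma iter_avg_cst n c : iter n avg (fun=> c) = (fun=> c).
Proof. by elim: n => [|n IHn] //; rewrite iterS IHn avg_cst. Qed.

Lemma iter_avg_ge0 n f : (forall y, 0 <= f y) -> forall x, 0 <= iter n avg f x.
Proof. by move=> f0 x; rewrite -[0]/((fun=> 0) x) -(iter_avg_cst n); apply: iter_avg_le. Qed.

Lemma iter_avg_harmonic n u : harmonic u -> iter n avg u = u.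
Proof. by move=> hu; elim: n => [|n IHn] //; rewrite iterS IHn; apply: funext. Qed.

Lemma harmonic_diff g u : harmonic u -> harmonic (diff g u).
Proof.
move=> hu x; rewrite /diff -(hu (x + g)) -(hu x) /avg -mulrBr -sumrB.
by congr (_ * _); apply: eq_bigr => i _; rewrite addrAC.
Qed.

Lemma harmonic_lin a u v : harmonic u -> harmonic v -> harmonic (fun x => a * u x + v x).
Proof. by move=> hu hv x; rewrite avg_lin hu hv. Qed.

Lemma avg_sub f x : avg f x - f x = N%:R^-1 * \sum_(i < N) diff (tnth S i) f x.
Proof.
rewrite /avg /diff sumrB sumr_const card_ord -[f x *+ _]mulr_natl mulrBr mulKf //.
exact: lt0r_neq0.
Qed.

(** Reduces the growth of walk averages of [f] in time to those of [avg f - f], which has lower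
    degree when [f] is a polynomial. *)
Lemma iter_avg_telescope n f x :
  iter n avg f x = f x + \sum_(k < n) iter k avg (fun y => avg f y - f y) x.
Proof.
elim: n => [|n IHn]; first by rewrite big_ord0 addr0.
rewrite big_ord_recr /= addrA -IHn -iterS iterSr.
have -> : (fun y => avg f y - f y) = (fun y => -1 * f y + avg f y).
  by apply: funext => y; ring.
by rewrite iter_avg_lin; ring.
Qed.

Lemma iter_avg_words n f x B :
  (forall w, size w = n -> f (x + wsum w) <= B) -> iter n avg f x <= B.
Proof.
elim: n x => [|n IHn] x fB.
  by have := fB [::] erefl; rewrite /wsum big_nil addr0.
rewrite iterS -[leRHS]/((fun=> B) x) -(avg_cst B) ler_pM2l ?invr_gt0 //.
apply: ler_sum => i _; apply: IHn => w szw.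
by have := fB (i :: w); rewrite wsum_cons addrA; apply; rewrite /= szw.
Qed.

Definition word_weight w : R :=
  (size w)`!%:R / (N%:R ^+ size w * \prod_(i < N) (count_mem i w)`!%:R).

Lemma word_weight_cons i w : word_weight (i :: w)
  = word_weight w * ((size w).+1%:R / (N%:R * (count_mem i w).+1%:R)).
Proof.
have prodE : \prod_(j < N) (count_mem j (i :: w))`!%:R
    = (count_mem i w).+1%:R * \prod_(j < N) (count_mem j w)`!%:R :> R.
  rewrite (bigD1 i) //= [in RHS](bigD1 i) //= eqxx add1n factS natrM -!mulrA.
  by congr (_ * (_ * _)); apply: eq_bigr => j ji; rewrite eq_sym (negPf ji).
rewrite /word_weight prodE [size (i :: w)]/= factS natrM exprS.
rewrite !invfM; ring.
Qed.

Lemma word_weight_perm w1 w2 : perm_eq w1 w2 -> word_weight w1 = word_weight w2.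
Proof.
move=> w12; rewrite /word_weight (perm_size w12); congr (_ / (_ * _)).
by apply: eq_bigr => i _; rewrite (permP w12).
Qed.

Lemma word_weight_gt0 w : 0 < word_weight w.
Proof.
rewrite divr_gt0 ?ltr0n ?fact_gt0 // mulr_gt0 ?exprn_gt0 //.
by apply: prodr_gt0 => i _; rewrite ltr0n fact_gt0.
Qed.

Lemma sum_count w : (\sum_(i < N) count_mem i w = size w)%N.
Proof.
elim: w => [|j w IHw] /=; first by rewrite big1.
rewrite big_split /= IHw (bigD1 j) //= eqxx big1 // => i ij.
by rewrite eq_sym (negPf ij).
Qed.

(* [word_weight w] is the probability that the first [size w] steps of the walk
   spell some permutation of [w]. *)
Lemma word_weight_le w v x : (forall y, 0 <= v y) ->
  word_weight w * v (x + wsum w) <= iter (size w) avg v x.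
Proof.
move=> v0; move: {2}(size w) (erefl (size w)) => n.
elim: n w x => [|n IHn] w x szw.
  rewrite (size0nil szw) /word_weight /wsum big_nil addr0 big1 //.
  by rewrite expr0 mulr1 fact0 divr1 mul1r.
rewrite szw iterS /avg ler_pdivlMl //.
(* Condition on the first step: the letter [i] opens a fraction [count_mem i w / n.+1] of the
   permutations of [w]. *)
have -> : N%:R * (word_weight w * v (x + wsum w)) = \sum_(i < N)
    N%:R * ((count_mem i w)%:R / n.+1%:R * (word_weight w * v (x + wsum w))).
  rewrite -mulr_sumr -mulr_suml -mulr_suml -natr_sum sum_count szw divff ?mul1r //.
  by rewrite pnatr_eq0.
apply: ler_sum => i _.
have [iw|iw] := boolP (i \in w); last first.
  by rewrite (count_memPn iw) !mul0r mulr0; apply: iter_avg_ge0.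
have sz : size (rem i w) = n by rewrite size_rem // szw.
have wE := perm_to_rem iw.
have -> : x + wsum w = x + tnth S i + wsum (rem i w).
  by rewrite -addrA -wsum_cons; congr (_ + _); apply: perm_big.
rewrite (word_weight_perm wE) word_weight_cons sz (permP wE) /= eqxx add1n.
have := IHn (rem i w) (x + tnth S i) sz; rewrite sz; apply: le_trans.
have n0 : N%:R != 0 :> R by apply: lt0r_neq0.
rewrite le_eqVlt; apply/orP; left; apply/eqP; field.
by rewrite -natrD n0 !(addrC 1) !natr1 !pnatr_eq0.
Qed.

(** A closed loop used as padding: it makes the letter counts nearly equal, where multinomial
    probabilities are largest. *)
Definition balanced_word M : seq 'I_N := flatten (nseq M (enum 'I_N)).

Lemma size_balanced M : size (balanced_word M) = (N * M)%N.
Proof. by elim: M => [|M IHM]; rewrite ?muln0 //= size_cat IHM size_enum_ord mulnS. Qed.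

Lemma count_balanced M i : count_mem i (balanced_word M) = M.
Proof.
elim: M => [|M IHM] //=; rewrite count_cat IHM count_uniq_mem ?enum_uniq //.
by rewrite mem_enum add1n.
Qed.

Lemma wsum_balanced M : wsum (balanced_word M) = 0.
Proof.
elim: M => [|M IHM]; first by rewrite /wsum big_nil.
by rewrite wsum_cat IHM addr0 /wsum big_enum /= sum_S0.
Qed.

(** Each prepended letter multiplies the weight by the new length over [N] times its new count. The
    length is at least [N * M] and the count at most [M + E]. *)
Lemma word_weight_cat M E w1 w2 : (0 < M)%N -> (N * M <= size w2)%N ->
  (forall i, count_mem i (w1 ++ w2) <= M + E)%N ->
  word_weight w2 * (M%:R / (M + E)%:R) ^+ size w1 <= word_weight (w1 ++ w2).
Proof.
move=> M0 Mw2; elim: w1 => [|i w1 IHw] cnt; first by rewrite expr0 mulr1.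
rewrite cat_cons word_weight_cons [size (i :: w1)]/= exprSr [leLHS]mulrA.
have N0 : (0 < N)%N by rewrite addn_gt0 r_gt0.
apply: ler_pM.
- by apply: mulr_ge0; [apply/ltW/word_weight_gt0 | apply/exprn_ge0/divr_ge0].
- by rewrite divr_ge0.
- by apply: IHw => j; apply: leq_trans (cnt j); rewrite leq_addl.
rewrite ler_pdivrMr ?ltr0n ?addn_gt0 ?M0 // mulrAC ler_pdivlMr; last first.
  by rewrite mulr_gt0 ?ltr0n.
rewrite -!natrM ler_nat.
have := cnt i; rewrite /= eqxx add1n => cnti.
rewrite mulnCA mulnA; apply: leq_mul => //.
by rewrite size_cat; lia.
Qed.

(** Passing from [M] to [M + 1] rounds costs at most a factor [(M / (M + 1)) ^ N], and these factors
    telescope: the decay is only polynomial. *)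
Lemma word_weight_balanced M : (0 < M)%N ->
  word_weight (balanced_word 1) <= word_weight (balanced_word M) * M%:R ^+ N.
Proof.
elim: M => [|[|M] IHM] // _; first by rewrite expr1n mulr1.
apply: le_trans (IHM isT) _.
have := @word_weight_cat M.+1 1 (enum 'I_N) (balanced_word M.+1) isT.
rewrite size_balanced leqnn size_enum_ord => /(_ isT) wc.
have {}wc : word_weight (balanced_word M.+1) * (M.+1%:R / (M.+1 + 1)%:R) ^+ N
    <= word_weight (balanced_word M.+2).
  apply: wc => i; have := count_balanced M.+2 i; rewrite /= => ->.
  by rewrite addn1.
have p0 : 0 < (M.+2%:R : R) ^+ N by rewrite exprn_gt0 ?ltr0n.
move: wc; rewrite -(ler_pM2r p0) addn1 expr_div_n mulrA mulfVK //.
exact: lt0r_neq0.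
Qed.

End Walk.

(** * Word metric and words in the generators *)

Section WordMetric.
Variables (G : zmodType) (r : nat) (S : (r + r).-tuple G).
Hypothesis S_gen : forall x, exists w, x = wsum S w.

Lemma joined_inP x y n :
  joined_in S x y n <-> exists2 w, size w = n & y = x + wsum S w.
Proof.
split=> [/asboolP[s [<- xs <-]]|[w <- ->]].
  elim: s x xs => [|z s IHs] x /=; first by exists [::]; rewrite // /wsum big_nil addr0.
  move=> /andP[/tnthP[i zxi] /IHs[w szw ->]]; exists (i :: w); first by rewrite /= szw.
  by rewrite wsum_cons -zxi addrA addrCA subrr addr0.
apply/asboolP; elim: w x => [|i w IHw] x.
  by exists [::]; split; rewrite // /wsum big_nil addr0.
have [s [szs xs lst]] := IHw (x + tnth S i).
exists (x + tnth S i :: s); split; rewrite /= ?szs //.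
  by rewrite xs /cayley addrAC subrr add0r mem_tnth.
by rewrite wsum_cons addrA.
Qed.

Lemma word_metric_word x y :
  exists2 w, size w = word_metric S x y & y = x + wsum S w.
Proof.
have [w yxw] := S_gen (y - x).
(* Generation rules out the default value 0 of [word_metric]. *)
have xy : exists n, joined_in S x y n.
  by exists (size w); apply/joined_inP; exists w; rewrite // -yxw addrCA subrr addr0.
rewrite /word_metric; case: pselect => // e; case: ex_minnP => n /joined_inP ? _.
by [].
Qed.

Lemma word_metric_le x w : (word_metric S x (x + wsum S w) <= size w)%N.
Proof.
have xw : joined_in S x (x + wsum S w) (size w) by apply/joined_inP; exists w.
by rewrite /word_metric; case: pselect => // e; case: ex_minnP => n _; apply.
Qed.

Lemma word_metric_walk x0 x w :
  (word_metric S x0 (x + wsum S w) <= word_metric S x0 x + size w)%N.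
Proof.
have [w0 <- ->] := word_metric_word x0 x.
by rewrite -addrA -wsum_cat -size_cat word_metric_le.
Qed.

End WordMetric.

(** * Harnack bound: one-sided growth implies polynomial growth *)

Section Harnack.
Variables (R : realType) (G : zmodType) (r : nat) (S : (r + r).-tuple G).
Local Notation N := (r + r)%N.
Hypothesis r_gt0 : (0 < r)%N.
Hypothesis S_sym : forall i : 'I_r, tnth S (rshift r i) = - tnth S (lshift r i).
Hypothesis S_gen : forall x, exists w, x = wsum S w.
Variable x0 : G.
Local Notation rho x := (word_metric S x0 x).+1.

(** Diffusive scaling: against [E ^ 2] balanced rounds, [E] extra letters cost a factor at least
    [(E / (E + 1)) ^ E], which is not exponentially small. *)
Lemma word_weight_padded E w : (0 < E)%N -> (size w <= E)%N ->
  word_weight R (balanced_word r 1)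
    <= word_weight R (w ++ balanced_word r (E ^ 2)) * (E.+1 * E ^ (2 * N))%:R.
Proof.
move=> E0 wE; set b := balanced_word r (E ^ 2).
have E20 : (0 < E ^ 2)%N by rewrite expn_gt0 E0.
have wc : word_weight R b * ((E ^ 2)%:R / (E ^ 2 + E)%:R) ^+ size w
    <= word_weight R (w ++ b).
  apply: word_weight_cat => // [|i]; first by rewrite size_balanced.
  by rewrite count_cat count_balanced addnC leq_add2l (leq_trans (count_size _ _)).
have ratio : E.+1%:R^-1 <= ((E ^ 2)%:R / (E ^ 2 + E)%:R) ^+ size w :> R.
  have -> : (E ^ 2)%:R / (E ^ 2 + E)%:R = 1 - E.+1%:R^-1 :> R.
    have e0 : E%:R != 0 :> R by rewrite pnatr_eq0 -lt0n.
    have e1 : 1 + E%:R != 0 :> R by rewrite addrC natr1 pnatr_eq0.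
    rewrite natrD natrX -natr1 [_ + 1]addrC; field.
    by rewrite e1 /= -natrX -natrD pnatr_eq0 -lt0n addn_gt0 E0 orbT.
  have e1 : E.+1%:R^-1 <= 1 :> R by rewrite invf_le1 ?ler1n ?ltr0n.
  apply: (@le_trans _ _ ((1 - E.+1%:R^-1) ^+ E)); last first.
    apply: ler_wiXn2l => //; first by rewrite subr_ge0.
    by rewrite lerBlDr lerDl invr_ge0.
  have bernoulli (t : R) k : 0 <= t -> t <= 1 -> 1 - k%:R * t <= (1 - t) ^+ k.
    move=> t0 t1; elim: k => [|k IHk]; first by rewrite mul0r subr0.
    rewrite exprS -natr1; apply: (@le_trans _ _ ((1 - t) * (1 - k%:R * t))).
      have : 0 <= k%:R * t * t by rewrite !mulr_ge0.
      lra.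
    by apply: ler_wpM2l => //; rewrite subr_ge0.
  apply: le_trans (bernoulli _ E _ e1); last by rewrite invr_ge0.
  have : E.+1%:R * E.+1%:R^-1 = 1 :> R by rewrite divff ?pnatr_eq0.
  by set t := _^-1; rewrite -natr1 mulrDl mul1r; lra.
apply: le_trans (@word_weight_balanced R _ r_gt0 _ E20) _.
rewrite natrM mulrA expnM -natrX.
apply: ler_wpM2r => //.
rewrite -ler_pdivrMr ?ltr0n //; apply: le_trans wc.
by apply: ler_wpM2l => //; apply/ltW/word_weight_gt0.
Qed.

Lemma one_sided_growth (u : G -> R) C D :
  harmonic S u -> (forall x, - C * (rho x)%:R ^+ D <= u x) ->
  exists C' D', 0 <= C' /\ forall x, `|u x| <= C' * (rho x)%:R ^+ D'.
Proof.
move=> hu ulo; set K := `|C|.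
have K0 : 0 <= K by exact: normr_ge0.
(* [v] is nonnegative but need not be harmonic; its walk average at [x0] is still [u x0] plus a
   polynomially bounded term. *)
pose v x := K * (rho x)%:R ^+ D + u x.
have v0 x : 0 <= v x.
  have := ulo x; rewrite /v; have := ler_norm C.
  have : 0 <= (rho x)%:R ^+ D :> R by exact: exprn_ge0.
  rewrite -/K; nra.
set a := word_weight R (balanced_word r 1).
have a0 : 0 < a by exact: word_weight_gt0.
(* In the exponent, [2 * D] comes from averaging over a time of order [E ^ 2], [2 * N] from the
   weight of the balanced word, and 1 from [E.+1 <= 2 * E]. *)
have vup x : v x <= a^-1 * (2 * (N.+2%:R ^+ D) * (`|u x0| + K))
    * (rho x)%:R ^+ (2 * D + 2 * N + 1).
  have [w szw xw] := word_metric_word S_gen x0 x.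
  set E := rho x; set W := w ++ balanced_word r (E ^ 2).
  have wE : (size w <= E)%N by rewrite szw.
  have := @word_weight_padded E w isT wE; rewrite -/a -/W => aW.
  have := @word_weight_le R G r S r_gt0 W v x0 v0.
  rewrite wsum_cat wsum_balanced // addr0 -xw.
  rewrite (iter_avg_lin S (size W) K) (iter_avg_harmonic _ hu) => Wv.
  have szW : ((size W).+1 <= N.+2 * E ^ 2)%N.
    rewrite size_cat size_balanced szw -[_.+1]/(E + N * E ^ 2)%N.
    have : (E <= E ^ 2)%N by rewrite expnS expn1 leq_pmulr.
    by move: (E ^ 2)%N => E2; rewrite -[N.+2]addn2 mulnDl; lia.
  have itup : iter (size W) (avg S) (fun x => (rho x)%:R ^+ D) x0
      <= (N.+2 * E ^ 2)%:R ^+ D :> R.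
    apply: iter_avg_words => // w' szw'; rewrite lerXn2r ?nnegrE // ler_nat.
    by apply: leq_trans szW; rewrite ltnS -szw' word_metric_le.
  have {Wv itup} Wv : word_weight R W * v x <= (`|u x0| + K) * (N.+2 * E ^ 2)%:R ^+ D.
    apply: (le_trans Wv); rewrite mulrDl addrC; apply: lerD.
      apply: (le_trans (ler_norm _)); rewrite ler_peMr // exprn_ege1 //.
      by rewrite ler1n muln_gt0.
    by apply: ler_wpM2l.
  have {aW} : a * v x <= (E.+1 * E ^ (2 * N))%:R * ((`|u x0| + K) * (N.+2 * E ^ 2)%:R ^+ D).
    apply: le_trans (ler_wpM2r (v0 x) aW) _.
    by rewrite -mulrA mulrCA; apply: ler_wpM2l.
  move=> av; rewrite -[leRHS]mulrA ler_pdivlMl //; apply: le_trans av _.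
  have -> : 2 * (N.+2%:R ^+ D) * (`|u x0| + K) * E%:R ^+ (2 * D + 2 * N + 1)
    = (2 * E * E ^ (2 * N))%:R * ((`|u x0| + K) * (N.+2 * E ^ 2)%:R ^+ D).
    rewrite !natrM !natrX -expr2 exprMn -exprM !exprD expr1; ring.
  apply: ler_wpM2r; first by rewrite mulr_ge0 ?addr_ge0 ?exprn_ge0.
  by rewrite ler_nat leq_mul2r; apply/orP; right; rewrite mul2n -addnn /E; lia.
exists (a^-1 * (2 * (N.+2%:R ^+ D) * (`|u x0| + K)) + K), (2 * D + 2 * N + 1)%N.
split.
  apply: addr_ge0 => //; apply: mulr_ge0; first by rewrite invr_ge0 ltW.
  by apply: mulr_ge0; [apply/mulr_ge0/exprn_ge0 | apply: addr_ge0].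
move=> x; have -> : u x = v x - K * (rho x)%:R ^+ D by rewrite /v; ring.
apply: (le_trans (ler_normB _ _)); rewrite mulrDl; apply: lerD.
  by rewrite ger0_norm.
rewrite ger0_norm ?mulr_ge0 ?exprn_ge0 //; apply: ler_wpM2l => //.
by apply: ler_weXn2l; rewrite ?ler1n //; lia.
Qed.

End Harnack.

(** * Gradient estimate *)

Lemma le0_of_le_divn (R : realType) (a K : R) :
  (forall J : nat, (0 < J)%N -> a <= K / J%:R) -> a <= 0.
Proof.
move=> aK; rewrite leNgt; apply/negP => a0.
have := aK (Num.truncn (K / a)).+1 isT.
have := truncnS_gt (K / a).
rewrite ltr_pdivrMr // ler_pdivlMr ?ltr0n // => lt1 /le_lt_trans/(_ lt1).
by rewrite mulrC ltxx.
Qed.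

(** A substitute for exponential decay: [(1 - t) ^+ n * (1 + n * t)] is nonincreasing in [n] and
    starts at 1. *)
Lemma onem_exp_le (R : realFieldType) (t : R) n : 0 <= t -> t <= 1 ->
  (1 - t) ^+ n * (n%:R * t) <= 1.
Proof.
move=> t0 t1; apply: (@le_trans _ _ ((1 - t) ^+ n * (1 + n%:R * t))).
  by rewrite ler_wpM2l ?exprn_ge0 ?subr_ge0 // lerDr.
elim: n => [|n IHn]; first by rewrite expr0 mul0r addr0 mul1r.
apply: le_trans IHn; rewrite exprSr -mulrA ler_wpM2l ?exprn_ge0 ?subr_ge0 //.
have : 0 <= n%:R * t * t by rewrite !mulr_ge0.
have : 0 <= t * t by rewrite mulr_ge0.
by rewrite -natr1; lra.
Qed.

Section Gradient.
Variables (R : realType) (G : zmodType) (r : nat) (S : (r + r).-tuple G).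
Local Notation N := (r + r)%N.
Hypothesis r_gt0 : (0 < r)%N.
Implicit Types (u : G -> R) (x : G) (w : seq 'I_N).

Let N_gt0 : 0 < N%:R :> R.
Proof. by rewrite ltr0n addn_gt0 r_gt0. Qed.

(* Coupling: walks started at [x] and [x + s *+ j] use the same steps, except
   that the steps "stay" and "s" are paired crosswise; this moves [j] to [j - 1]
   or [j + 1].  [barrier J k j] is a supersolution for the probability of
   neither meeting nor separating to distance [J] within [k] steps, plus that of
   reaching distance [J] first. *)
Definition barrier (J : R) k (t : R) : R :=
  t / J + (1 - (2 * N%:R * J ^+ 2)^-1) ^+ k * ((J ^+ 2 + t * (J - t)) / J ^+ 2).

(** Induction on the time [k]. The difference vanishes at [j = 0], is trivially at most [2 * B] at
    [j = J], and in between [barrier] is a supersolution. The radius [k + J] contains every position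
    of both walks. *)
Lemma coupling_bound u J i (B : R) k j x : harmonic S u -> (0 < J)%N -> (j <= J)%N ->
  (forall w, (size w <= k + J)%N -> `|u (x + wsum S w)| <= B) ->
  `|u (x + tnth S i *+ j) - u x| <= 2 * B * barrier J%:R k j%:R.
Proof.
move=> hu J0; have J0' : 0 < J%:R :> R by rewrite ltr0n.
set s := tnth S i; pose c : R := 2 * N%:R * J%:R ^+ 2.
have c0 : 0 < c by rewrite /c !mulr_gt0 ?exprn_gt0.
have c1 : 1 <= c.
  by rewrite /c -!natrX -!natrM ler1n !muln_gt0 addn_gt0 r_gt0 J0.
have lam0 : 0 <= 1 - c^-1 by rewrite subr_ge0 invf_le1.
have chi_ge j' : (j' <= J)%N -> 1 <= (J%:R ^+ 2 + j'%:R * (J%:R - j'%:R)) / J%:R ^+ 2 :> R.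
  move=> j'J; rewrite ler_pdivlMr ?exprn_gt0 // mul1r lerDl mulr_ge0 //.
  by rewrite subr_ge0 ler_nat.
have bar_ge0 k' j' : (j' <= J)%N -> 0 <= barrier J%:R k' j'%:R.
  move=> j'J; rewrite addr_ge0 ?divr_ge0 // mulr_ge0 ?exprn_ge0 //.
  exact: le_trans ler01 (chi_ge _ j'J).
have trivial_bound k' j' y : (j' <= J)%N ->
    (forall w, (size w <= k' + J)%N -> `|u (y + wsum S w)| <= B) ->
    0 <= B /\ `|u (y + s *+ j') - u y| <= 2 * B.
  move=> j'J uB; split; first by apply: le_trans (uB [::] _); rewrite ?normr_ge0.
  rewrite mulr_natl mulr2n; apply: (le_trans (ler_normB _ _)); apply: lerD.
    have -> : s *+ j' = wsum S (nseq j' i) by rewrite /wsum big_nseq iter_addr_0.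
    by apply: uB; rewrite size_nseq (leq_trans j'J) ?leq_addl.
  by have := uB [::]; rewrite /wsum big_nil addr0; apply.
elim: k j x => [|k IHk] j x jJ uB; have [B0 uB2] := trivial_bound _ _ _ jJ uB.
  apply: (le_trans uB2); rewrite ler_peMr ?mulr_ge0 //.
  by rewrite /barrier expr0 mul1r -[leLHS]add0r lerD ?divr_ge0 ?chi_ge.
case: j jJ uB2 => [|j] jJ uB2.
  by rewrite addr0 subrr normr0 !mulr_ge0 ?bar_ge0.
move: jJ; rewrite leq_eqVlt => /predU1P[jJ|jJ].
  apply: (le_trans uB2); rewrite ler_peMr ?mulr_ge0 //.
  rewrite /barrier jJ divff ?lt0r_neq0 // lerDl mulr_ge0 ?exprn_ge0 //.
  exact: le_trans ler01 (chi_ge _ _).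
have uBk w : (size w <= k + J)%N -> `|u (x + wsum S w)| <= B.
  by move=> szw; apply: uB; rewrite addSn ltnW.
have uBi l w : (size w <= k + J)%N -> `|u (x + tnth S l + wsum S w)| <= B.
  by move=> szw; rewrite -addrA -wsum_cons; apply: uB; rewrite addSn.
set y := x + s *+ j.+1.
(* Lazy walk: [N] of the [2 * N] equally likely moves stay put. Pairing one stay with the step [s]
   crosswise gives the separations [j.+2] and [j]; all other pairs keep [j.+1]. *)
have split : 2 * N%:R * (u y - u x) = (N%:R - 1) * (u y - u x)
    + (\sum_(l < N | l != i) (u (y + tnth S l) - u (x + tnth S l))
       + ((u (x + s *+ j.+2) - u x) + (u (x + s + s *+ j) - u (x + s)))).
  have -> : 2 * N%:R * (u y - u x) = N%:R * (u y - u x)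
      + \sum_(l < N) (u (y + tnth S l) - u (x + tnth S l)).
    rewrite sumrB -[\sum_(l < N) u (y + _)](mulVKf (lt0r_neq0 N_gt0)).
    rewrite -[\sum_(l < N) u (x + _)](mulVKf (lt0r_neq0 N_gt0)).
    rewrite -!/(avg S u _) !hu; ring.
  have -> : x + s + s *+ j = y by rewrite /y mulrS addrA.
  have -> : x + s *+ j.+2 = y + s by rewrite /y mulrSr addrA.
  rewrite (bigD1 i) //= -/s; ring.
have IHl l : `|u (y + tnth S l) - u (x + tnth S l)| <= 2 * B * barrier J%:R k j.+1%:R.
  by rewrite /y addrAC; apply: IHk (ltnW jJ) (uBi l).
have N1 : 0 <= N%:R - 1 :> R by rewrite subr_ge0 ler1n addn_gt0 r_gt0.
have cardN : \sum_(l < N | l != i) 1 = N%:R - 1 :> R.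
  by rewrite sumr_const cardC1 card_ord -subn1 natrB // addn_gt0 r_gt0.
have bound : 2 * N%:R * `|u y - u x| <= 2 * B * ((2 * N%:R - 2) * barrier J%:R k j.+1%:R
    + barrier J%:R k j.+2%:R + barrier J%:R k j%:R).
  have -> : 2 * B * ((2 * N%:R - 2) * barrier J%:R k j.+1%:R
      + barrier J%:R k j.+2%:R + barrier J%:R k j%:R)
    = (N%:R - 1) * (2 * B * barrier J%:R k j.+1%:R)
      + (\sum_(l < N | l != i) 1 * (2 * B * barrier J%:R k j.+1%:R)
         + (2 * B * barrier J%:R k j.+2%:R + 2 * B * barrier J%:R k j%:R)).
    rewrite -mulr_suml cardN; ring.
  rewrite -[2 * N%:R]gtr0_norm ?mulr_gt0 // -normrM split.
  apply: (le_trans (ler_normD _ _)); apply: lerD.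
    rewrite normrM ger0_norm //; apply: ler_wpM2l => //.
    exact: IHk (ltnW jJ) uBk.
  apply: (le_trans (ler_normD _ _)); apply: lerD.
    apply: (le_trans (ler_norm_sum _ _ _)).
    by apply: ler_sum => l _; rewrite mul1r.
  apply: (le_trans (ler_normD _ _)); apply: lerD; first exact: IHk jJ uBk.
  by apply: IHk (ltnW (ltnW jJ)) (uBi i).
have N2 : 0 < 2 * N%:R :> R by rewrite mulr_gt0.
rewrite -(ler_pM2l N2); apply: (le_trans bound).
rewrite [leRHS]mulrCA; apply: ler_wpM2l; first exact: mulr_ge0.
rewrite /barrier -/c [_ ^+ k.+1]exprS.
have lamk : 0 <= (1 - c^-1) ^+ k by exact: exprn_ge0.
set L := (1 - c^-1) ^+ k in lamk *.
set t : R := j.+1%:R.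
have -> : j.+2%:R = t + 1 :> R by rewrite natr1.
have -> : j%:R = t - 1 :> R by rewrite /t -natr1 addrK.
have tJ : t <= J%:R by rewrite ler_nat ltnW.
have t0 : 0 <= t by [].
rewrite -subr_ge0.
have n0 : r%:R + r%:R != 0 :> R by rewrite -natrD lt0r_neq0.
have j0 : J%:R != 0 :> R by rewrite lt0r_neq0.
(* The linear part of [barrier] averages exactly. Up to the factor [L], concavity of the quadratic
   part gains [2 / J ^ 2], and the decay [1 - c^-1] costs [1 / J ^ 2] times the quadratic factor,
   which is at most 2. *)
rewrite [leRHS](_ : _ = L / J%:R ^+ 2 *
    (2 - (J%:R ^+ 2 + t * (J%:R - t)) / J%:R ^+ 2)); last first.
  by rewrite /c natrD; field; rewrite n0 j0.
rewrite mulr_ge0 ?divr_ge0 ?exprn_ge0 // subr_ge0 ler_pdivrMr ?exprn_gt0 //.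
nra.
Qed.

(** Start the coupling at separation 1 and run it for time [J ^ 3], longer than the relaxation time
    [2 * N * J ^ 2] by a factor of order [J]: both terms of [barrier] become [O(1/J)]. *)
Lemma gradient_bound u J i (B : R) x : harmonic S u -> (0 < J)%N ->
  (forall w, (size w <= J ^ 3 + J)%N -> `|u (x + wsum S w)| <= B) ->
  `|diff (tnth S i) u x| <= 2 * (1 + 4 * N%:R) / J%:R * B.
Proof.
move=> hu J0 uB; have J0' : 0 < J%:R :> R by rewrite ltr0n.
have B0 : 0 <= B by apply: le_trans (uB [::] _); rewrite ?normr_ge0.
have := coupling_bound i hu J0 J0 uB; rewrite mulr1n => /le_trans; apply.
rewrite -[leLHS]mulrA -![leRHS]mulrA mulrC -mulrA.
rewrite [leRHS](_ : _ = 2 * (B * ((1 + 4 * N%:R) / J%:R))); last by ring.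
rewrite [leLHS](_ : _ = 2 * (B * barrier J%:R (J ^ 3) 1)); last by ring.
do 2 apply: ler_wpM2l => //.
set c := 2 * N%:R * J%:R ^+ 2 : R.
have J1 : 1 <= J%:R :> R by rewrite ler1n.
have N1 : 1 <= N%:R :> R by rewrite ler1n addn_gt0 r_gt0.
have c0 : 0 < c by rewrite /c !mulr_gt0 ?exprn_gt0.
have c1 : c^-1 <= 1.
  rewrite invf_le1 // /c -!natrX -!natrM ler1n !muln_gt0 addn_gt0 r_gt0 J0 //.
have := @onem_exp_le R c^-1 (J ^ 3) _ c1; rewrite invr_ge0 (ltW c0) => /(_ isT).
rewrite /barrier -/c.
have : 0 <= (1 - c^-1) ^+ (J ^ 3) by rewrite exprn_ge0 // subr_ge0.
move: (_ ^+ (J ^ 3)) => L L0.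
have -> : (J ^ 3)%:R / c = J%:R / (2 * N%:R) :> R.
  rewrite /c natrX; field.
  by rewrite -natrD !lt0r_neq0.
rewrite mulrA ler_pdivrMr ?mulr_gt0 // => LJ.
rewrite [leRHS]mulrDl; apply: lerD => //.
rewrite ler_pdivlMr //; apply: (@le_trans _ _ (L * J%:R * 2)); last by lra.
rewrite mulrAC; apply: ler_wpM2l; first exact: mulr_ge0.
by rewrite ler_pdivrMr ?exprn_gt0 //; nra.
Qed.

Definition diffs w u := foldr (fun i f => diff (tnth S i) f) u w.

Lemma harmonic_diffs w u : harmonic S u -> harmonic S (diffs w u).
Proof. by move=> hu; elim: w => [|i w IHw] //; apply: harmonic_diff. Qed.

Lemma diffs_bound u J l (B : R) x : harmonic S u -> (0 < J)%N ->
  (forall w, (size w <= size l * (J ^ 3 + J))%N -> `|u (x + wsum S w)| <= B) ->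
  `|diffs l u x| <= (2 * (1 + 4 * N%:R) / J%:R) ^+ size l * B.
Proof.
move=> hu J0; elim: l x => [|i l IHl] x uB.
  by have := uB [::] isT; rewrite /wsum big_nil addr0 mul1r.
rewrite exprS -[leRHS]mulrA; apply: gradient_bound => // [|w szw].
  exact: harmonic_diffs.
apply: IHl => w' szw'; rewrite -addrA -wsum_cat; apply: uB.
by rewrite size_cat mulSn leq_add.
Qed.

Hypothesis S_gen : forall x, exists w, x = wsum S w.

(** Up to shifts, differences are additive along words, so the generators suffice to test the
    degree. *)
Lemma deg_lt_gen n u :
  (forall i, deg_lt n (diff (tnth S i) u)) -> deg_lt n.+1 u.
Proof.
move=> nu g; have [w ->] := S_gen g; elim: w => [|i w IHw].
  rewrite (_ : diff _ u = fun=> 0); first exact: deg_lt0.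
  by apply: funext => x; rewrite /diff /wsum big_nil addr0 subrr.
rewrite wsum_cons (_ : diff _ u = fun x => diff (tnth S i) u (x + wsum S w)
  + diff (wsum S w) u x); last by apply: funext => x; rewrite diff_additive.
by apply: deg_lt_add IHw; apply: deg_lt_shift.
Qed.

Lemma deg_lt_diffs n u :
  (forall l, size l = n -> forall x, diffs l u x = 0) -> deg_lt n u.
Proof.
elim: n u => [|n IHn] u lu; first exact: (lu [::]).
apply: deg_lt_gen => i; apply: IHn => l szl x.
by have := lu (rcons l i); rewrite size_rcons szl /diffs foldr_rcons; apply.
Qed.

(** On a ball of radius [O(J ^ 3)] the function is [O(J ^ (3 * D))], while [3 * D + 1] differences
    gain [J ^ -(3 * D + 1)]. The net factor [1 / J] tends to 0. *)
Lemma harmonic_polynomial u x0 (C : R) D : harmonic S u ->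
  (forall x, `|u x| <= C * (word_metric S x0 x).+1%:R ^+ D) ->
  deg_lt (3 * D + 1) u.
Proof.
move=> hu uC; have C0 : 0 <= C.
  have p0 : 0 < (word_metric S x0 x0).+1%:R ^+ D :> R by rewrite exprn_gt0.
  by rewrite -(pmulr_lge0 _ p0) (le_trans _ (uC x0)).
apply: deg_lt_diffs => l szl x.
apply/eqP; rewrite -normr_le0; set n := size l in szl.
set a := (word_metric S x0 x).+1.
apply: (@le0_of_le_divn _ _ ((2 * (1 + 4 * N%:R)) ^+ n * (C * (a + 2 * n)%:R ^+ D))).
move=> J J0.
have := @diffs_bound u J l (C * ((a + 2 * n) * J ^ 3)%:R ^+ D) x hu J0.
rewrite -/n => /(_ _)/le_trans; apply.
  move=> w szw; apply: (le_trans (uC _)); apply: ler_wpM2l => //.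
  rewrite lerXn2r ?nnegrE // ler_nat.
  have := word_metric_walk S_gen x0 x w; rewrite -ltnS -addSn -/a => /leq_trans; apply.
  have J3 : (J <= J ^ 3)%N by rewrite -{1}[J]expn1 leq_pexp2l.
  have : (a * 1 <= a * J ^ 3)%N by rewrite leq_mul2l expn_gt0 J0 orbT.
  have : (n * J <= n * J ^ 3)%N by rewrite leq_mul2l J3 orbT.
  by rewrite mulnDr in szw; rewrite mulnDl -mulnA; lia.
rewrite szl natrM natrX [(_ * _ ^+ 3) ^+ D]exprMn -exprM expr_div_n [J%:R ^+ _]exprD expr1.
have j0 : J%:R != 0 :> R by rewrite pnatr_eq0 -lt0n.
have jD : J%:R ^+ (3 * D) != 0 :> R by rewrite expf_neq0.
rewrite le_eqVlt; apply/orP; left; apply/eqP; field.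
by rewrite jD j0.
Qed.

End Gradient.

(** * Moments and energy *)

Section Moments.
Variables (R : realType) (G : zmodType) (r : nat) (S : (r + r).-tuple G).
Local Notation N := (r + r)%N.
Hypothesis r_gt0 : (0 < r)%N.
Hypothesis S_sym : forall i : 'I_r, tnth S (rshift r i) = - tnth S (lshift r i).
Hypothesis S_gen : forall x, exists w, x = wsum S w.
Implicit Types (f u : G -> R) (x : G).

Let N_neq0 : N%:R != 0 :> R.
Proof. by rewrite pnatr_eq0 -lt0n addn_gt0 r_gt0. Qed.

(** By symmetry of [S], pairing [s] with [- s] turns [avg f - f] into a combination of second
    differences. *)
Lemma deg_lt_avg n f : deg_lt n.+2 f -> deg_lt n (fun x => avg S f x - f x).
Proof.
move=> nf; have -> : (fun x => avg S f x - f x) = (fun x => (- (2 * N%:R)^-1) *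
    \sum_(i < N) diff (tnth S i) (diff (- tnth S i) f) x).
  apply: funext => x; rewrite (eq_bigr (fun i => 2 * f x -
      (f (x + tnth S i) + f (x + - tnth S i)))); last first.
    by move=> i _; rewrite /diff addrK; ring.
  rewrite sumrB big_split /=.
  have -> : \sum_(i < N) f (x + - tnth S i) = \sum_(i < N) f (x + tnth S i).
    exact: (sum_sym S_sym (fun s => f (x + s))).
  rewrite sumr_const card_ord /avg -mulr_natl.
  have := N_neq0; move: (\sum_(i < N) _) => s; rewrite natrD => n0; field.
  by rewrite n0.
by apply: deg_lt_scale; apply: deg_lt_sum => i; apply: nf.
Qed.

Lemma iter_avg_scale n a f x :
  iter n (avg S) (fun y => a * f y) x = a * iter n (avg S) f x.
Proof.
rewrite (_ : (fun _ => _) = fun y => a * f y + 0); last first.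
  by apply: funext => y; rewrite addr0.
by rewrite iter_avg_lin iter_avg_cst // addr0.
Qed.

(** Each application of [deg_lt_avg] lowers the degree by two, and the telescoping sum pays one
    power of the time for it. *)
Lemma moment_bound j f x : deg_lt j.*2.+1 f ->
  exists2 C, 0 <= C & forall n, `|iter n (avg S) f x| <= C * n.+1%:R ^+ j.
Proof.
elim: j f => [|j IHj] f nf.
  exists `|f x| => // n; rewrite mulr1.
  suff -> : iter n (avg S) f = f by [].
  elim: n => [|n IHn] //; rewrite iterS IHn; apply: funext => y.
  apply/eqP; rewrite -subr_eq0 avg_sub // big1 ?mulr0 // => i _.
  exact: nf.
have [C C0 fC] := IHj _ (deg_lt_avg nf).
exists (`|f x| + C); first exact: addr_ge0.
move=> n; rewrite iter_avg_telescope; apply: (le_trans (ler_normD _ _)).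
rewrite mulrDl; apply: lerD; first by rewrite ler_peMr // exprn_ege1 // ler1n.
apply: (le_trans (ler_norm_sum _ _ _)).
apply: (@le_trans _ _ (\sum_(k < n) (C * n.+1%:R ^+ j))); last first.
  rewrite sumr_const card_ord exprSr mulrA -[leLHS]mulr_natr.
  by apply: ler_wpM2l; rewrite ?mulr_ge0 ?exprn_ge0 // ler_nat.
apply: ler_sum => k _; apply: (le_trans (fC k)); apply: ler_wpM2l => //.
by rewrite lerXn2r ?nnegrE // ler_nat ltnS ltnW.
Qed.

(** For harmonic [u], averaging raises the square by the mean of the squared differences. Some
    generator difference has degree exactly one less, so by induction each of [n] further steps
    gains a term of the previous order. This is why the time is [K * n]. *)
Lemma energy_lower_bound K u : harmonic S u -> deg_lt K.+1 u -> ~ deg_lt K u ->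
  exists2 c, 0 < c & forall n x,
    c * n%:R ^+ K <= iter (K * n) (avg S) (fun y => u y ^+ 2) x.
Proof.
elim: K u => [|K IHK] u hu Ku nKu.
  have /existsNP[x ux] := nKu.
  exists (u x ^+ 2); first by rewrite exprn_even_gt0 //; apply/eqP.
  move=> n y; rewrite mulr1 /=; have := Ku (y - x) x.
  by rewrite /diff addrCA subrr addr0 => /eqP; rewrite subr_eq0 => /eqP ->.
have [i ni] : exists i, ~ deg_lt K (diff (tnth S i) u).
  by apply: contrapT => /forallNP nu; apply/nKu/deg_lt_gen => // i; apply: contrapT.
have [c c0 uc] := IHK _ (harmonic_diff (tnth S i) hu) (Ku _) ni.
have N0 : 0 < N%:R :> R by rewrite lt0r N_neq0 ler0n.
exists (N%:R^-1 * c); first by rewrite mulr_gt0 ?invr_gt0.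
move=> n x; rewrite mulSn iterD.
set g := fun y => u y ^+ 2; set h := fun y => avg S g y - g y.
set F := iter (K * n) (avg S) g.
have hge y : N%:R^-1 * diff (tnth S i) u y ^+ 2 <= h y.
  rewrite /h avg_sub // ler_pM2l ?invr_gt0 //.
  rewrite (eq_bigr (fun j => diff (tnth S j) u y ^+ 2
    + 2 * u y * diff (tnth S j) u y)); last by move=> j _; rewrite /diff /g; ring.
  rewrite big_split /= -mulr_sumr.
  have /eqP : avg S u y - u y = 0 by rewrite hu subrr.
  rewrite avg_sub // mulf_eq0 invr_eq0 (negPf N_neq0) => /eqP ->.
  rewrite mulr0 addr0 (bigD1 i) //= lerDl.
  by apply: sumr_ge0 => j _; rewrite sqr_ge0.
have Fh y : avg S F y - F y = iter (K * n) (avg S) h y.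
  rewrite /h (_ : (fun _ => _) = fun y => -1 * g y + avg S g y); last first.
    by apply: funext => z; ring.
  by rewrite iter_avg_lin -iterSr iterS /F; ring.
rewrite iter_avg_telescope exprSr.
have F0 : 0 <= F x by apply: iter_avg_ge0 => // y; rewrite sqr_ge0.
apply: le_trans (_ : \sum_(k < n) (N%:R^-1 * c * n%:R ^+ K) <= _).
  by rewrite sumr_const card_ord -[leRHS]mulr_natr mulrA.
apply: (@le_trans _ _ (\sum_(k < n) iter k (avg S) (fun y => avg S F y - F y) x)).
  apply: ler_sum => k _.
  rewrite -[leLHS]/((fun=> N%:R^-1 * c * n%:R ^+ K) x).
  rewrite -(iter_avg_cst S r_gt0 k); apply: iter_avg_le => // y.
  rewrite Fh -mulrA; apply: (@le_trans _ _ (N%:R^-1 *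
    iter (K * n) (avg S) (fun y => diff (tnth S i) u y ^+ 2) y)).
    by rewrite ler_pM2l ?invr_gt0.
  by rewrite -iter_avg_scale //; apply: iter_avg_le.
by rewrite lerDr.
Qed.

End Moments.

(** * Word length compared with lattice coordinates *)

Section Lattice.
Variables (R : realType) (G : zmodType) (r m : nat) (S : (r + r).-tuple G).
Hypothesis S_gen : forall x, exists w, x = wsum S w.
Variables (proj : {additive G -> 'rV[int]_m}) (e : 'I_m -> G) (q : nat).
Hypothesis proj_e : forall j, proj (e j) = delta_mx 0 j.
Hypothesis q_gt0 : (0 < q)%N.
Hypothesis proj_ker : forall t, proj t = 0 -> t *+ q = 0.
Implicit Types (f u : G -> R) (x g : G).

Local Notation len := (word_metric S 0).

Definition section_of (z : 'rV[int]_m) : G := \sum_j e j *~ z 0 j.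

Lemma section_ofK z : proj (section_of z) = z.
Proof.
rewrite raddf_sum; apply/rowP => k; rewrite summxE (bigD1 k) //= big1 => [|j jk].
  by rewrite raddfMz proj_e -scaler_int !mxE !eqxx mulr1 addr0 intz.
by rewrite raddfMz proj_e -scaler_int !mxE eqxx /= eq_sym (negPf jk) mulr0.
Qed.

Lemma section_ofD : {morph section_of : z1 z2 / z1 + z2}.
Proof. by move=> z1 z2; rewrite -big_split; apply: eq_bigr => j _; rewrite mxE mulrzDr. Qed.

Lemma section_of0 : section_of 0 = 0.
Proof. by rewrite /section_of big1 // => j _; rewrite mxE mulr0z. Qed.

Lemma len_dist x g : (word_metric S x (x + g) <= len g)%N.
Proof.
have [w <- ->] := word_metric_word S_gen 0 g.
by rewrite add0r word_metric_le.
Qed.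

Lemma lenD g h : (len (g + h) <= len g + len h)%N.
Proof.
have [w <- ->] := word_metric_word S_gen 0 h.
by rewrite add0r word_metric_walk.
Qed.

Lemma len0 : len 0 = 0%N.
Proof.
have := word_metric_le S 0 [::].
by rewrite /wsum big_nil addr0 leqn0 => /eqP.
Qed.

Lemma len_sum (I : finType) (F : I -> G) :
  (len (\sum_i F i) <= \sum_i len (F i))%N.
Proof.
elim/big_rec2: _ => [|i a g _ ag]; first by rewrite len0.
by rewrite (leq_trans (lenD _ _)) // leq_add2l.
Qed.

Lemma len_mulrn g k : (len (g *+ k) <= k * len g)%N.
Proof.
elim: k => [|k IHk]; first by rewrite len0.
by rewrite mulrS mulSn (leq_trans (lenD _ _)) // leq_add2l.
Qed.

Lemma len_mulrz g (z : int) : (len (g *~ z) <= `|z| * (len g + len (- g)))%N.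
Proof.
case: z => k.
  by rewrite (leq_trans (len_mulrn _ _)) // leq_mul2l leq_addr orbT.
rewrite NegzE mulrNz -mulNrn abszN (leq_trans (len_mulrn _ _)) //.
by rewrite leq_mul2l leq_addl orbT.
Qed.

(* An element is its lattice part plus a combination of the torsion parts of
   the generators, whose coefficients may be reduced modulo [q]. *)
Lemma len_bound : exists c : nat, forall g,
  (len g <= c * (1 + \sum_j `|proj g 0%R j|))%N.
Proof.
pose tor i := tnth S i - section_of (proj (tnth S i)).
have torq i : tor i *+ q = 0.
  by apply: proj_ker; rewrite raddfB section_ofK subrr.
pose T := (\sum_i q * len (tor i))%N.
pose a := (\sum_j (len (e j) + len (- e j)))%N.
exists (T + a)%N => g; have [w ->] := S_gen g.
have wE : wsum S w = section_of (proj (wsum S w))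
    + \sum_i tor i *+ (count_mem i w %% q).
  elim: w => [|i w IHw].
    by rewrite /wsum big_nil raddf0 section_of0 add0r big1 // => i _; rewrite mod0n.
  rewrite !wsum_cons raddfD section_ofD.
  have -> : \sum_j tor j *+ (count_mem j (i :: w) %% q)
      = tor i + \sum_j tor j *+ (count_mem j w %% q).
    rewrite (bigD1 i) //= [in RHS](bigD1 i) //= addrA; congr (_ + _).
      rewrite eqxx -[tor i in RHS]mulr1n -mulrnDr.
      have mod k : tor i *+ (k %% q) = tor i *+ k.
        by rewrite [in RHS](divn_eq k q) mulrnDr mulnC mulrnA torq mul0rn add0r.
      by rewrite mulrnDr !mod mulrnDr.
    by apply: eq_bigr => j ji; rewrite eq_sym (negPf ji).
  by rewrite {1}IHw /tor; rewrite addrACA [section_of _ + (_ - _)]addrC subrK.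
rewrite [X in len X]wE; apply: (leq_trans (lenD _ _)); rewrite addnC mulnDl.
apply: leq_add.
  apply: (@leq_trans T); last by rewrite mulnDr muln1 leq_addr.
  apply: (leq_trans (len_sum _)); apply: leq_sum => i _.
  by apply: (leq_trans (len_mulrn _ _)); rewrite leq_mul2r ltnW ?orbT // ltn_pmod.
apply: (leq_trans (len_sum _)).
rewrite mulnDr muln1; apply: leq_trans (leq_addl _ _).
rewrite big_distrr /=; apply: leq_sum => j _.
apply: (leq_trans (len_mulrz _ _)); rewrite mulnC leq_mul2r; apply/orP; right.
by rewrite /a (bigD1 j) //= leq_addr.
Qed.

Lemma deg_lt_coord j (x0 : G) : deg_lt 2 (fun x => (proj (x - x0) 0 j)%:~R : R).
Proof.
move=> g; have -> : diff g (fun x => (proj (x - x0) 0 j)%:~R : R)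
    = fun=> (proj g 0 j)%:~R; last exact: deg_lt_cst.
by apply: funext => x; rewrite /diff addrAC raddfD mxE intrD addrAC subrr add0r.
Qed.

(** The word metric is not a polynomial; majorizing its square by one makes [moment_bound]
    applicable. *)
Lemma quadratic_majorant (x0 : G) : exists2 f : G -> R, deg_lt 3 f &
  forall x, (word_metric S x0 x).+1%:R ^+ 2 <= f x.
Proof.
have [c lenc] := len_bound.
pose Q x : R := 1 + \sum_j (proj (x - x0) 0 j)%:~R ^+ 2.
exists (fun x => ((c + 1) * (m + 1))%:R ^+ 2 * Q x).
  apply: deg_lt_scale; apply: deg_lt_add; first exact: deg_lt_cst.
  apply: deg_lt_sum => j; under eq_fun do rewrite expr2.
  by have := deg_ltM (@deg_lt_coord j x0) (@deg_lt_coord j x0).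
move=> x; have sq0 : 0 <= \sum_j (proj (x - x0) 0 j)%:~R ^+ 2 :> R.
  by apply: sumr_ge0 => j _; rewrite sqr_ge0.
have Q1 : 1 <= Q x by rewrite lerDl.
have Q0 : 0 <= Q x by lra.
have M1 : 1 <= Num.sqrt (Q x) by rewrite -sqrtr1 ler_sqrt ?ltr01 // (lt_le_trans ltr01).
rewrite -[X in _ <= _ * X](sqr_sqrtr Q0) -exprMn.
rewrite lerXn2r ?nnegrE ?mulr_ge0 ?sqrtr_ge0 //.
have abs_le j : `|proj (x - x0)%R 0%R j|%N%:R <= Num.sqrt (Q x).
  rewrite -(@ler_pXn2r _ 2) ?nnegrE ?sqrtr_ge0 // sqr_sqrtr //.
  rewrite /Q (bigD1 j) //= natr_absz intr_norm real_normK ?num_real //.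
  rewrite addrCA lerDl addr_ge0 // sumr_ge0 // => k _; exact: sqr_ge0.
have : ((word_metric S x0 x).+1 <= (c + 1) * (1 + \sum_j `|proj (x - x0)%R 0%R j|))%N.
  have := len_dist x0 (x - x0); rewrite addrCA subrr addr0 => /leq_trans/(_ (lenc _)).
  by rewrite mulnDl mul1n; lia.
rewrite -(ler_nat R) => /le_trans; apply.
rewrite !natrM -mulrA; apply: ler_wpM2l => //.
rewrite !natrD natr_sum addrC mulrDl mul1r; apply: lerD => //.
rewrite (_ : m%:R * _ = \sum_(j < m) Num.sqrt (Q x)); first exact: ler_sum.
by rewrite sumr_const card_ord mulr_natl.
Qed.

End Lattice.

(** * Degree of a harmonic polynomial with a one-sided bound *)

Section OneSided.
Variables (R : realType) (G : zmodType) (r m : nat) (S : (r + r).-tuple G).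
Local Notation N := (r + r)%N.
Hypothesis r_gt0 : (0 < r)%N.
Hypothesis S_sym : forall i : 'I_r, tnth S (rshift r i) = - tnth S (lshift r i).
Hypothesis S_gen : forall x, exists w, x = wsum S w.
Variables (proj : {additive G -> 'rV[int]_m}) (e : 'I_m -> G) (q : nat).
Hypothesis proj_e : forall j, proj (e j) = delta_mx 0 j.
Hypothesis q_gt0 : (0 < q)%N.
Hypothesis proj_ker : forall t, proj t = 0 -> t *+ q = 0.
Implicit Types (f u : G -> R) (x g : G).
Variables (d : R) (x0 : G).
Hypothesis d_ge0 : 0 <= d.

Lemma growth_ge1 x : 1 <= growth S d x0 x.
Proof. by rewrite -(powRr0 ((word_metric S x0 x)%:R + 1)) ler_powR // lerDr. Qed.

Lemma growth_ge0 x : 0 <= growth S d x0 x.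
Proof. exact: le_trans ler01 (growth_ge1 x). Qed.

Lemma growth_le_pow k x : d <= k%:R ->
  growth S d x0 x <= (word_metric S x0 x).+1%:R ^+ k.
Proof. by move=> dk; rewrite -natr1 -powR_mulrn ?addr_ge0 // ler_powR // lerDr. Qed.

Lemma growth_ge_pow k x : k%:R <= d ->
  (word_metric S x0 x).+1%:R ^+ k <= growth S d x0 x.
Proof. by move=> dk; rewrite -natr1 -powR_mulrn ?addr_ge0 // ler_powR // lerDr. Qed.

(** The real power is interpolated at scale [t]: with [a] the distance plus one, [a ^ d] is at most
    [t ^ d] if [a <= t], and at most [t ^ d * (a / t) ^ (2 * K)] otherwise. At time [K * t ^ 2] the
    moment of order [2 * K] is [O(t ^ (2 * K))]. *)
Lemma walk_growth K : d <= K%:R -> exists2 C : R, 0 <= C & forall t, (0 < t)%N ->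
  iter (K * t ^ 2) (avg S) (growth S d x0) x0 <= C * t%:R `^ d.
Proof.
move=> dK; have [f f3 ftwo] := quadratic_majorant R S_gen proj_e q_gt0 proj_ker x0.
have [C C0 fC] := moment_bound r_gt0 S_sym x0 (deg_ltX K f3).
exists (1 + C * (K.+1%:R ^+ K)); first by rewrite addr_ge0 // mulr_ge0 // exprn_ge0.
move=> t t0; have t0' : 0 < t%:R :> R by rewrite ltr0n.
have td : 0 <= t%:R `^ d :> R by exact: powR_ge0.
have gle x : growth S d x0 x <= t%:R `^ d / t%:R ^+ (K.*2) * f x ^+ K + t%:R `^ d.
  have f0 : 0 <= f x ^+ K by rewrite exprn_ge0 // (le_trans _ (ftwo x)) // exprn_ge0.
  set a : R := (word_metric S x0 x)%:R + 1.
  have a0 : 0 < a by rewrite /a natr1 ltr0n.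
  have [at_|ta] := leP a t%:R.
    rewrite -[leLHS]add0r lerD //; first by rewrite mulr_ge0 // divr_ge0 // exprn_ge0.
    by rewrite /growth ge0_ler_powR ?nnegrE // ltW.
  rewrite -[leLHS]addr0 lerD //.
  apply: (@le_trans _ _ (t%:R `^ d / t%:R ^+ K.*2 * a ^+ K.*2)); last first.
    apply: ler_wpM2l; first by rewrite divr_ge0 // exprn_ge0.
    rewrite -mul2n exprM lerXn2r ?nnegrE ?sqr_ge0 ?(le_trans _ (ftwo x)) ?sqr_ge0 //.
    by rewrite /a natr1.
  rewrite mulrAC ler_pdivlMr ?exprn_gt0 // /growth -/a.
  have -> : t%:R `^ d * a ^+ K.*2 = a `^ d * t%:R ^+ K.*2 * (a / t%:R) `^ (K.*2%:R - d).
    have ex (s : R) : 0 < s -> s ^+ K.*2 = s `^ d * s `^ (K.*2%:R - d).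
      by move=> s0; rewrite -powRD ?lt0r_neq0 ?implybT // addrCA subrr addr0 powR_mulrn // ltW.
    rewrite powRM ?invr_ge0 ?ltW // -powR_inv1 ?ltW // -powRrM mulN1r !ex //.
    rewrite powRN; have := powR_gt0 (K.*2%:R - d) t0'.
    move: (t%:R `^ (K.*2%:R - d)) => s s0; field; exact: lt0r_neq0.
  rewrite ler_peMr ?mulr_ge0 ?exprn_ge0 ?powR_ge0 //.
  rewrite -[leLHS](powRr0 (a / t%:R)) ler_powR //; first by rewrite ler_pdivlMr // mul1r ltW.
  by rewrite subr_ge0 (le_trans dK) // ler_nat -addnn leq_addr.
apply: (le_trans (iter_avg_le _ r_gt0 _ gle _)).
rewrite iter_avg_lin iter_avg_cst // mulrDl mul1r [leRHS]addrC lerD2r.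
rewrite mulrAC ler_pdivrMr ?exprn_gt0 // mulrC mulrAC; apply: ler_wpM2r => //.
apply: (le_trans (ler_norm _)); apply: (le_trans (fC _)).
rewrite -mulrA; apply: ler_wpM2l => //.
rewrite -mul2n exprM -exprMn lerXn2r ?nnegrE ?mulr_ge0 ?exprn_ge0 //.
rewrite -natrX -natrM ler_nat mulSn addnC -addn1 leq_add2l expn_gt0 t0 //.
Qed.

Lemma one_sided_degree u C K : harmonic S u -> deg_lt K.+1 u -> d < K%:R ->
  (forall x, - C * growth S d x0 x <= u x) -> deg_lt K u.
Proof.
move=> hu Ku dK ulo; apply: contrapT => nKu.
have [c c0 cu] := energy_lower_bound r_gt0 S_gen hu Ku nKu.
have [A A0 gA] := walk_growth (ltW dK).
have u4 : deg_lt (K.*2).*2.+1 (fun x => u x ^+ 4).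
  have := deg_ltM Ku Ku; rewrite (_ : _.-1 = K.*2.+1) => [u2|]; last by lia.
  have := deg_ltM u2 u2; rewrite (_ : _.-1 = (K.*2).*2.+1); last by lia.
  congr deg_lt.
  by apply: funext => x; ring.
have [A4 A40 uA4] := moment_bound r_gt0 S_sym x0 u4.
set K0 : R := `|C|.
have K00 : 0 <= K0 by exact: normr_ge0.
have ulo' x : - K0 * growth S d x0 x <= u x.
  apply: le_trans (ulo x); apply: ler_wpM2r; first exact: growth_ge0.
  by rewrite lerN2 ler_norm.
(* [|u|] is [u] plus twice its negative part, which the lower bound controls; the average of [u]
   stays equal to [u x0]. *)
have absu x : `|u x| <= 2 * K0 * growth S d x0 x + u x.
  have : 0 <= K0 * growth S d x0 x by apply: mulr_ge0; rewrite ?growth_ge0.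
  by have := ulo' x => ? ?; rewrite ler_norml; apply/andP; split; lra.
pose A1 := 2 * K0 * A + `|u x0|.
have A10 : 0 <= A1 by rewrite addr_ge0 // mulr_ge0 // mulr_ge0.
pose A5 := A4 * K.+1%:R ^+ K.*2.
have A50 : 0 <= A5 by rewrite mulr_ge0 // exprn_ge0.
(* Large enough that [A5 / B ^ 2 <= c / 2]: half of the energy absorbs the fourth-moment term. *)
pose B := 1 + 2 * A5 / c.
have B1 : 1 <= B by rewrite /B lerDl; apply: divr_ge0; [exact: mulr_ge0|exact: ltW].
have B0 : 0 < B by apply: lt_le_trans B1.
have key t : (0 < t)%N -> c * t%:R ^+ K.*2 <=
    B * t%:R ^+ K * (A1 * t%:R `^ d) + A5 * t%:R ^+ K.*2 / B ^+ 2.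
  move=> t0; have t0' : 0 < t%:R :> R by rewrite ltr0n.
  pose T := B * t%:R ^+ K; have T0 : 0 < T by rewrite mulr_gt0 // exprn_gt0.
  have := cu (t ^ 2)%N x0; rewrite natrX -exprM mul2n => /le_trans; apply.
  (* Truncation at height [T]: the first term suffices where [|u| <= T], the second where
     [|u| > T]. *)
  have u2 x : u x ^+ 2 <= T * (2 * K0 * growth S d x0 x + u x) + (T ^+ 2)^-1 * u x ^+ 4.
    apply: (@le_trans _ _ (T * `|u x| + (T ^+ 2)^-1 * u x ^+ 4)); last first.
      by rewrite lerD2r ler_pM2l.
    have -> : u x ^+ 4 = `|u x| ^+ 4 by rewrite -normrX ger0_norm // exprn_even_ge0.
    rewrite -[u x ^+ 2]real_normK ?num_real //; set b := `|u x|.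
    have b0 : 0 <= b by exact: normr_ge0.
    have [bT|Tb] := leP b T.
      rewrite -[leLHS]addr0; apply: lerD; first by rewrite expr2; apply: ler_wpM2r.
      by apply: mulr_ge0; rewrite ?invr_ge0 ?exprn_ge0 // ltW.
    rewrite -[leLHS]add0r; apply: lerD; first by apply: mulr_ge0 => //; apply: ltW.
    rewrite mulrC ler_pdivlMr ?exprn_gt0 // -[4%N]/(2 + 2)%N exprD.
    by rewrite ler_wpM2l ?exprn_ge0 // lerXn2r ?nnegrE // ltW.
  apply: (le_trans (iter_avg_le _ r_gt0 _ u2 _)).
  rewrite [X in iter _ _ X](_ : _ = fun x => T * (2 * K0 * growth S d x0 x + u x)
      + ((T ^+ 2)^-1 * u x ^+ 4 + 0)); last by apply: funext => x; rewrite addr0.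
  rewrite !iter_avg_lin iter_avg_cst // addr0 (iter_avg_harmonic _ hu).
  apply: lerD.
    apply: ler_wpM2l; first exact: ltW.
    rewrite /A1 [leRHS]mulrDl; apply: lerD.
      rewrite -[leRHS]mulrA; apply: ler_wpM2l; first exact: mulr_ge0.
      exact: gA.
    apply: (le_trans (ler_norm _)); rewrite ler_peMr //.
    by rewrite -[leLHS](powRr0 t%:R) ler_powR // ler1n.
  rewrite mulrC ler_pdivrMr ?exprn_gt0 //.
  have -> : A5 * t%:R ^+ K.*2 / B ^+ 2 * T ^+ 2 = A4 * (K.+1%:R * t%:R ^+ 2) ^+ K.*2.
    have tK : t%:R ^+ K.*2 = (t%:R ^+ K) ^+ 2 :> R by rewrite -muln2 exprM.
    rewrite [(_ * t%:R ^+ 2) ^+ _]exprMn [t%:R ^+ 2 ^+ _]exprAC tK /T /A5.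
    move: (K.+1%:R ^+ K.*2) (t%:R ^+ K) => a y; field; exact: lt0r_neq0.
  apply: (le_trans (ler_norm _)); apply: (le_trans (uA4 _)).
  apply: ler_wpM2l => //; rewrite lerXn2r ?nnegrE ?mulr_ge0 ?exprn_ge0 //.
  by rewrite -natrX -natrM ler_nat mulSn addnC -addn1 leq_add2l expn_gt0 t0.
pose X := 2 * B * A1 / c.
have X0 : 0 <= X.
  by apply: divr_ge0; [apply: mulr_ge0 => //; apply: mulr_ge0 => //|]; apply: ltW.
have del : 0 < K%:R - d by rewrite subr_gt0.
have powX t : (0 < t)%N -> t%:R `^ (K%:R - d) <= X.
  move=> t0; have t0' : 0 < t%:R :> R by rewrite ltr0n.
  have /key : (0 < t)%N by [].
  have -> : t%:R ^+ K.*2 = t%:R ^+ K * (t%:R `^ d * t%:R `^ (K%:R - d)) :> R.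
    rewrite -powRD ?lt0r_neq0 ?implybT // addrCA subrr addr0 powR_mulrn //.
    by rewrite -exprD addnn.
  have := powR_gt0 d t0'; have : 0 < t%:R ^+ K :> R by rewrite exprn_gt0.
  move: (t%:R ^+ K) (t%:R `^ d) (t%:R `^ _) (powR_ge0 t%:R (K%:R - d)) => a b y y0 a0 b0.
  have -> : B * a * (A1 * b) + A5 * (a * (b * y)) / B ^+ 2
    = a * b * (B * A1 + A5 / B ^+ 2 * y) by field; exact: lt0r_neq0.
  rewrite (_ : c * _ = a * b * (c * y)); last by ring.
  rewrite ler_pM2l ?mulr_gt0 // => cy.
  have AB : A5 / B ^+ 2 <= c / 2.
    rewrite ler_pdivrMr ?exprn_gt0 //.
    apply: (@le_trans _ _ (c / 2 * B)); last first.
      by rewrite ler_wpM2l ?divr_ge0 ?(ltW c0) // expr2 ler_peMr // ltW.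
    have -> : c / 2 * B = c / 2 + A5 by rewrite /B; field; exact: lt0r_neq0.
    by rewrite lerDr divr_ge0 // ltW.
  rewrite /X ler_pdivlMr //.
  have := ler_wpM2r y0 AB; lra.
(* A time scale with [t ^ (K - d) >= X + 1], which contradicts [powX]. *)
pose t := (Num.truncn ((X + 1) `^ (K%:R - d)^-1)).+1.
have := powX t isT; apply/negP; rewrite -ltNge.
apply: (@lt_le_trans _ _ (X + 1)); first by rewrite ltrDl.
have -> : X + 1 = ((X + 1) `^ (K%:R - d)^-1) `^ (K%:R - d).
  by rewrite -powRrM mulVf ?lt0r_neq0 // powRr1 // addr_ge0.
rewrite ge0_ler_powR ?nnegrE ?powR_ge0 ?ltW // /t.
exact: truncnS_gt.
Qed.

End OneSided.

(** * Kernels of constant-coefficient operators *)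

Section TriangularSystem.
Variables (R : realType) (V : lmodType R) (I : finType).
Variables (free : pred I) (rank : I -> nat) (M : I -> I -> R).
Hypothesis M_lt : forall i j, ~~ free i -> M i j != 0 -> (rank j < rank i)%N.

Definition triangular_step (f c : I -> R) : I -> R :=
  fun i => if free i then f i else \sum_j M i j * c j.

(** After [n] steps the values at ranks below [n] are final; the sum of all ranks is a convenient
    bound for the largest one. *)
Definition triangular_sol (f : I -> R) : I -> R :=
  iter (\sum_i rank i).+1 (triangular_step f) (fun=> 0).

Lemma triangular_step_local f c1 c2 i :
  (forall j, (rank j < rank i)%N -> c1 j = c2 j) ->
  triangular_step f c1 i = triangular_step f c2 i.
Proof.
move=> c12; rewrite /triangular_step; case: ifPn => // fi.
apply: eq_bigr => j _; have [->|/(M_lt fi)/c12 ->] // := eqVneq (M i j) 0.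
by rewrite !mul0r.
Qed.

Lemma triangular_solE f i : triangular_sol f i = triangular_step f (triangular_sol f) i.
Proof.
have stab n : forall j, (rank j < n)%N ->
    iter n (triangular_step f) (fun=> 0) j = iter n.+1 (triangular_step f) (fun=> 0) j.
  elim: n => [|n IHn] j // jn; rewrite iterS [in RHS]iterS.
  apply: triangular_step_local => l lj; apply: IHn.
  exact: leq_trans lj _.
rewrite {1}/triangular_sol stab // ltnS (bigD1 i) //=; exact: leq_addr.
Qed.

Lemma triangular_unique f c1 c2 : (forall i, c1 i = triangular_step f c1 i) ->
  (forall i, c2 i = triangular_step f c2 i) -> forall i, c1 i = c2 i.
Proof.
move=> h1 h2 i; move: {2}(rank i).+1 (ltnSn (rank i)) => n.
elim: n i => [|n IHn] i // ri; rewrite h1 h2; apply: triangular_step_local => j ji.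
by apply: IHn; apply: leq_trans ji _.
Qed.

Variables (B : I -> V) (A : set V).
Hypothesis B_free : forall c : I -> R, \sum_i c i *: B i = 0 -> forall i, c i = 0.
Hypothesis A_E : forall v, A v <-> exists2 c : I -> R, v = \sum_i c i *: B i &
  forall i, ~~ free i -> c i = \sum_j M i j * c j.

(** Values on [free] extend uniquely to solutions; the basis consists of the extensions of Kronecker
    deltas. *)
Lemma triangular_dim : has_dim A #|free|.
Proof.
pose dl (j : 'I_#|free|) i : R := (i == enum_val j)%:R.
pose sol j := triangular_sol (dl j).
have solF (a : 'I_#|free| -> R) i : ~~ free i ->
    \sum_j a j * sol j i = \sum_l M i l * \sum_j a j * sol j l.
  move=> fi; under [RHS]eq_bigr do rewrite mulr_sumr.
  rewrite exchange_big; apply: eq_bigr => j _.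
  rewrite /sol triangular_solE /triangular_step (negPf fi) mulr_sumr.
  by apply: eq_bigr => l _; rewrite mulrCA.
have sol_free j (j0 : 'I_#|free|) : sol j (enum_val j0) = (j == j0)%:R.
  rewrite /sol triangular_solE /triangular_step.
  have -> : free (enum_val j0) by have := enum_valP j0.
  by rewrite /dl (inj_eq enum_val_inj) eq_sym.
have sumB (a : 'I_#|free| -> R) : \sum_j a j *: (\sum_i sol j i *: B i)
    = \sum_i (\sum_j a j * sol j i) *: B i.
  under eq_bigr do rewrite scaler_sumr.
  rewrite exchange_big; apply: eq_bigr => i _; rewrite scaler_suml.
  by apply: eq_bigr => j _; rewrite scalerA.
have sum_at (a : 'I_#|free| -> R) j0 : \sum_j a j * sol j (enum_val j0) = a j0.
  rewrite (bigD1 j0) //= sol_free eqxx mulr1 big1 ?addr0 // => j jj0.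
  by rewrite sol_free (negPf jj0) mulr0.
exists (fun j => \sum_i sol j i *: B i); split.
  move=> v; rewrite A_E; split=> [[c -> cE]|[a ->]].
    exists (fun j => c (enum_val j)); rewrite sumB; apply: eq_bigr => i _.
    congr (_ *: _).
    apply: (@triangular_unique c c (fun i => \sum_j c (enum_val j) * sol j i)) => {}i.
      by rewrite /triangular_step; case: ifPn => // /cE.
    rewrite /triangular_step; case: ifPn => fi; last exact: solF.
    by rewrite -[i in LHS](enum_rankK_in fi fi) sum_at (enum_rankK_in fi fi).
  by rewrite sumB; exists (fun i => \sum_j a j * sol j i) => // i; apply: solF.
move=> a; rewrite sumB => /B_free a0 j.
by rewrite -(sum_at a j).
Qed.

End TriangularSystem.

Section KernelDimension.
Variables (R : realType) (V : lmodType R) (m k : nat) (i0 : 'I_m).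
Local Notation I := (bmultinom m k.+1).
Local Notation two i := (mnm_add (mnm1 i) (mnm1 i)).
Variables (F : multinom m -> R) (B : I -> V) (A : set V).
Hypothesis F_low : forall g, (mdeg g < 2)%N -> F g = 0.
Hypothesis F_two : F (two i0) != 0.
Hypothesis B_free : forall c : I -> R, \sum_i c i *: B i = 0 -> forall i, c i = 0.
Hypothesis A_E : forall v, A v <-> exists2 c : I -> R, v = \sum_i c i *: B i &
  forall b, \sum_(i : I | lem b i) c i * F (mnm_sub i b) = 0.

(* The equation at [b] determines the coefficient at [b + two i0] from those of
   higher total degree, or of equal total degree and lower degree in [i0]: the
   coefficients with [i0]-exponent at most 1 are Cauchy data. *)
Lemma kernel_dim : has_dim A #|[pred i : I | (i i0 <= 1)%N]|.
Proof.
(* [mnm_sub] truncates, but row [i] of [M] is only used when the [i0]-exponent is at least 2. It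
   solves the equation at [base i] for the coefficient at [i]. *)
pose base (i : I) := mnm_sub i (two i0).
pose M (i j : I) : R := if lem (base i) j && (j != i) then
  - F (mnm_sub j (base i)) / F (two i0) else 0.
(* Lexicographic order in one number: exponents are at most [k], so the weight [k.+1] lets the total
   degree dominate. *)
pose rank (i : I) := ((k - mdeg i) * k.+1 + i i0)%N.
have twoE l : (two i0) l = ((i0 == l) * 2)%N by rewrite mnmDE mnm1E muln2 addnn.
have le_mdeg (g : multinom m) l : (g l <= mdeg g)%N.
  by rewrite mdegE (bigD1 l) //= leq_addr.
have base_le (i : I) : ~~ (i i0 <= 1)%N -> lem (two i0) i.
  move=> fi; apply/mnm_lepP => l; rewrite twoE; case: eqP => // <-.
  by rewrite mul1n ltnNge.
have mdeg_two : mdeg (two i0) = 2%N by rewrite mdegD !mdeg1.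
apply: (@triangular_dim R V I [pred i : I | (i i0 <= 1)%N] rank M _ B A) => // [i j fi|v].
  rewrite /M; case: ifPn => [/andP[bj ji]|_]; last by rewrite eqxx.
  move=> Mij; set g := mnm_sub j (base i) in Mij.
  have jE : mnm_add g (base i) = j by apply: submK.
  have iE : mnm_add (base i) (two i0) = i by apply: submK; apply: base_le.
  have g2 : (2 <= mdeg g)%N.
    by rewrite leqNgt; apply/negP => /F_low g0; rewrite g0 oppr0 mul0r eqxx in Mij.
  have dj : mdeg j = (mdeg g + mdeg (base i))%N by rewrite -jE mdegD.
  have di : mdeg i = (mdeg (base i) + 2)%N by rewrite -iE mdegD mdeg_two.
  have jk := bmdeg j; have ik := bmdeg i.
  have ji0 := le_mdeg j i0.
  rewrite /rank; move: g2; rewrite leq_eqVlt => /predU1P[g2|g2].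
    have -> : mdeg j = mdeg i by lia.
    rewrite ltn_add2l -jE -iE !mnmDE !mnm1E eqxx addnC ltn_add2l ltnNge.
    apply/negP => gi0; move/negP: ji; apply; apply/eqP/val_inj.
    rewrite /= -jE -iE addmC; congr mnm_add; apply/mnmP => l; rewrite twoE.
    move: g2; rewrite mdegE (bigD1 i0) //=; have [<- g2|il] := eqVneq i0 l; first by lia.
    by rewrite (bigD1 l) ?(eq_sym l) //=; lia.
  have : (k - mdeg j < k - mdeg i)%N by lia.
  move: (k - mdeg j)%N (k - mdeg i)%N => a b ab.
  have : (a.+1 * k.+1 <= b * k.+1)%N by rewrite leq_mul2r ab orbT.
  by rewrite mulSn; lia.
rewrite A_E.
have eqE (c : I -> R) (i : I) : ~~ (i i0 <= 1)%N ->
    \sum_(j : I | lem (base i) j) c j * F (mnm_sub j (base i))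
    = F (two i0) * (c i - \sum_j M i j * c j).
  move=> fi; have iE : mnm_add (base i) (two i0) = i by apply: submK; apply: base_le.
  have bi : lem (base i) i.
    by apply/mnm_lepP => l; rewrite -[in leqRHS]iE mnmDE leq_addr.
  rewrite (bigD1 i) //= mulrBr mulrC; congr (_ * _ + _).
    by congr F; rewrite -{1}iE addmC addmK.
  rewrite mulr_sumr -sumrN [RHS](bigID [pred j : I | lem (base i) j && (j != i)]) /=.
  rewrite [X in _ + X]big1 ?addr0; last first.
    by move=> j /negPf bj; rewrite /M bj mul0r mulr0 oppr0.
  by apply: eq_bigr => j bj; rewrite /M bj; field.
split=> -[c -> cE]; exists c => //; [move=> i fi|move=> b].
  have /eqP := cE (base i); rewrite eqE // mulf_eq0 (negPf F_two) subr_eq0.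
  by move=> /eqP.
(* If [mdeg b + 2] exceeds [k], only shifts of degree below 2 occur and the equation at [b] is
   vacuous. *)
have [bk|kb] := ltnP (mdeg b + 2) k.+1; last first.
  apply: big1 => i bi; rewrite F_low ?mulr0 //.
  have : mdeg (mnm_add (mnm_sub i b) b) = mdeg i by rewrite submK.
  by rewrite mdegD; have := bmdeg i; lia.
have b2k : (mdeg (mnm_add b (two i0)) < k.+1)%N by rewrite mdegD mdeg_two.
pose i := BMultinom b2k.
have fi : ~~ (i i0 <= 1)%N by rewrite /= mnmDE twoE eqxx; lia.
have <- : base i = b by rewrite /base /= addmK.
by rewrite eqE // cE // subrr mulr0.
Qed.

End KernelDimension.

(** * Continuous harmonic polynomials in divided powers *)

Section HarmonicPolynomials.
Variables (R : realType) (m k : nat) (i0 : 'I_m).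
Local Notation I := (bmultinom m k.+1).
Local Notation two i := (mnm_add (mnm1 i) (mnm1 i)).

Definition mnm_fact (g : multinom m) : R := (\prod_j (g j)`!)%:R.

Lemma mnm_fact_neq0 g : mnm_fact g != 0.
Proof. by rewrite pnatr_eq0 -lt0n prodn_gt0 // => j; rewrite fact_gt0. Qed.

Lemma mnm_fact_add1 g i : mnm_fact (mnm_add g (mnm1 i)) = (g i).+1%:R * mnm_fact g.
Proof.
rewrite /mnm_fact (bigD1 i) //= [in RHS](bigD1 i) //= -natrM mulnA -factS.
rewrite mnmDE mnm1E eqxx addn1; congr (_ * _)%:R; apply: eq_bigr => j ji.
by rewrite mnmDE mnm1E eq_sym (negPf ji) addn0.
Qed.

(** On coefficients multiplied by [mnm_fact], differentiation is a pure shift of exponents, without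
    numerical factors. *)
Lemma mcoeff_laplacian (u : mpoly m R) g :
  mnm_fact g * mcoeff g (mpoly_laplacian u)
  = \sum_i mnm_fact (mnm_add g (two i)) * mcoeff (mnm_add g (two i)) u.
Proof.
rewrite /mpoly_laplacian raddf_sum mulr_sumr; apply: eq_bigr => i _.
rewrite /= !mcoeff_deriv addmA !mnm_fact_add1.
move: (mcoeff _ _) (mnm_fact g) (mnm_add _ _ i) (g i) => c a x y.
by rewrite -mulrnA -[c *+ _]mulr_natl natrM; ring.
Qed.

Lemma mcoeff_comb (c : I -> R) g : mcoeff g (\sum_i c i *: mpolyX R i)
  = \sum_(i : I | bmnm i == g) c i.
Proof.
rewrite raddf_sum [RHS]big_mkcond; apply: eq_bigr => i _.
by rewrite /= mcoeffZ mcoeffX; case: eqP; rewrite ?mulr1 ?mulr0.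
Qed.

Lemma HP_dim : has_dim (HP R m k) #|[pred i : I | (i i0 <= 1)%N]|.
Proof.
(* The symbol of the continuous Laplacian: one shift by [two i] for each second partial
   derivative. *)
pose F (g : multinom m) : R := \sum_i (g == two i)%:R.
have comb_bmnm (c : I -> R) (j : I) : \sum_(i : I | bmnm i == bmnm j) c i = c j.
  by rewrite (big_pred1 j).
apply: (@kernel_dim R _ m k i0 F (fun i : I => (mnm_fact i)^-1 *: mpolyX R i)).
- move=> g g2; rewrite /F big1 // => i _; case: eqP g2 => // ->.
  by rewrite mdegD !mdeg1.
- by rewrite /F -natr_sum pnatr_eq0 (bigD1 i0) //= eqxx.
- move=> c c0 j; have := congr1 (mcoeff j) c0.
  under eq_bigr do rewrite scalerA.
  rewrite mcoeff_comb comb_bmnm raddf0 => /eqP.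
  by rewrite mulf_eq0 invr_eq0 (negPf (mnm_fact_neq0 _)) orbF => /eqP.
have FE (c : I -> R) (u : mpoly m R) b :
    (forall g, mnm_fact g * mcoeff g u = \sum_(i : I | bmnm i == g) c i) ->
    \sum_(i : I | lem b i) c i * F (mnm_sub i b) = mnm_fact b * mcoeff b (mpoly_laplacian u).
  move=> cu; rewrite mcoeff_laplacian /F.
  under eq_bigr do rewrite mulr_sumr.
  rewrite exchange_big; apply: eq_bigr => l _; rewrite cu [RHS]big_mkcond [LHS]big_mkcond /=.
  apply: eq_bigr => i _; case: ifPn => bi.
    have -> : (mnm_sub i b == two l) = (bmnm i == mnm_add b (two l)).
      apply/eqP/eqP => [<-|->]; first by rewrite addmC submK.
      by rewrite addmC addmK.
    by case: eqP; rewrite ?mulr1 ?mulr0.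
  case: eqP => // iE; case/negP: bi; rewrite iE; apply/mnm_lepP => j.
  by rewrite mnmDE leq_addr.
move=> v; split=> [[Lu uk]|[c -> cE]].
  pose c (i : I) := mnm_fact i * mcoeff i v.
  exists c.
    rewrite [LHS](mpolywE uk); apply: eq_bigr => i _.
    by rewrite scalerA /c mulrAC mulfV ?mul1r ?mnm_fact_neq0.
  move=> b; rewrite (FE c v) ?Lu ?mcoeff0 ?mulr0 // => g.
  have [gk|kg] := ltnP (mdeg g) k.+1; first by rewrite (comb_bmnm _ (BMultinom gk)).
  rewrite big1 => [|i /eqP ig]; last by have := bmdeg i; rewrite ig ltnNge kg.
  by rewrite memN_msupp_eq0 ?mulr0 // msize_mdeg_ge // (leq_trans uk).
set u := \sum_i _.
have uE : u = \sum_i (c i / mnm_fact i) *: mpolyX R i.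
  by apply: eq_bigr => i _; rewrite scalerA.
have cu g : mnm_fact g * mcoeff g u = \sum_(i : I | bmnm i == g) c i.
  rewrite uE mcoeff_comb mulr_sumr; apply: eq_bigr => i /eqP <-.
  by rewrite mulrCA mulfV ?mulr1 ?mnm_fact_neq0.
split.
  apply/mpolyP => b; rewrite mcoeff0; have := cE b; rewrite (FE c u b cu) => /eqP.
  by rewrite mulf_eq0 (negPf (mnm_fact_neq0 _)) => /eqP.
rewrite uE; apply: (leq_trans (msize_sum _ _ _)).
apply/bigmax_leqP => i _; apply: (leq_trans (msizeZ_le _ _)).
by rewrite msizeX; apply: bmdeg.
Qed.

End HarmonicPolynomials.

(** * Lattice polynomials *)

Section LatticePolynomials.
Variables (R : realType) (G : zmodType) (m : nat).
Variables (proj : {additive G -> 'rV[int]_m}) (e : 'I_m -> G).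
Hypothesis proj_e : forall j, proj (e j) = delta_mx 0 j.
Implicit Types (f u : G -> R) (x g : G) (l : seq 'I_m) (a b : multinom m).

(** The binomial coefficient [t] over [n] as a polynomial in [t], so that negative coordinates are
    covered. *)
Definition binom_poly (n : nat) (t : R) : R := (\prod_(i < n) (t - i%:R)) / n`!%:R.

Lemma binom_poly0 t : binom_poly 0 t = 1.
Proof. by rewrite /binom_poly big_ord0 fact0 divr1. Qed.

Lemma binom_poly1 t : binom_poly 1 t = t.
Proof. by rewrite /binom_poly big_ord1 subr0 divr1. Qed.

Lemma binom_poly2 t : binom_poly 2 t = (t ^+ 2 - t) / 2.
Proof. by rewrite /binom_poly !big_ord_recl big_ord0 /= /bump /= subr0 !mulr1 mulrBr mulr1. Qed.

Lemma binom_poly_at0 n : binom_poly n 0 = (n == 0%N)%:R.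
Proof.
case: n => [|n]; first by rewrite binom_poly0.
by rewrite /binom_poly big_ord_recl subrr !mul0r.
Qed.

Lemma binom_poly_diff n t : binom_poly n.+1 (t + 1) = binom_poly n.+1 t + binom_poly n t.
Proof.
rewrite /binom_poly big_ord_recl [in RHS]big_ord_recr /= factS natrM subr0.
rewrite (eq_bigr (fun i : 'I_n => t - i%:R)) => [|i _]; last first.
  by rewrite /bump /= add1n -natr1; ring.
have f0 : n`!%:R != 0 :> R by rewrite pnatr_eq0 -lt0n fact_gt0.
have n0 : n.+1%:R != 0 :> R by rewrite pnatr_eq0.
rewrite -natr1 in n0 *; move: (\prod_(i < n) _) => P; field.
by rewrite f0 n0.
Qed.

Definition lattice_poly a x : R := \prod_j binom_poly (a j) (proj x 0 j)%:~R.

(** Pascal's rule in the coordinate [j]. The case distinction is needed because [mnm_sub] truncates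
    when the exponent of [j] is 0. *)
Lemma diff_lattice_poly j a : diff (e j) (lattice_poly a)
  = if lem (mnm1 j) a then lattice_poly (mnm_sub a (mnm1 j)) else fun=> 0.
Proof.
apply: funext => x; rewrite /diff /lattice_poly (bigD1 j) //= [X in _ - X](bigD1 j) //=.
have -> : \prod_(i < m | i != j) binom_poly (a i) (proj (x + e j) 0 i)%:~R
    = \prod_(i < m | i != j) binom_poly (a i) (proj x 0 i)%:~R.
  apply: eq_bigr => i ij; rewrite raddfD proj_e !mxE eqxx /= (negPf ij).
  by rewrite addr0.
rewrite raddfD proj_e !mxE !eqxx rmorphD /= -mulrBl.
have -> : lem (mnm1 j) a = (0 < a j)%N.
  apply/mnm_lepP/idP => [/(_ j)|aj i]; rewrite mnm1E ?eqxx //.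
  by case: eqP => // <-.
case: ifP => [aj|/negbT]; last first.
  by rewrite -eqn0Ngt => /eqP ->; rewrite !binom_poly0 subrr mul0r.
rewrite [RHS](bigD1 j) //= mnmBE mnm1E eqxx subn1.
rewrite -[in LHS](prednK aj) binom_poly_diff addrAC subrr add0r; congr (_ * _).
by apply: eq_bigr => i ij; rewrite mnmBE mnm1E eq_sym (negPf ij) subn0.
Qed.

Lemma deg_lt_prod (I : Type) (s : seq I) (n : I -> nat) (F : I -> G -> R) :
  (forall i, deg_lt (n i).+1 (F i)) ->
  deg_lt (\sum_(i <- s) n i).+1 (fun x => \prod_(i <- s) F i x).
Proof.
move=> nF; elim: s => [|i s IHs].
  rewrite (_ : (fun x => _) = fun=> 1); first exact: deg_lt_cst.
  by apply: funext => x; rewrite big_nil.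
rewrite (_ : (fun x => _) = fun x => F i x * \prod_(j <- s) F j x); last first.
  by apply: funext => x; rewrite big_cons.
by have := deg_ltM (nF i) IHs; rewrite big_cons addnS addSn.
Qed.

Lemma deg_lt_lattice_poly a : deg_lt (mdeg a).+1 (lattice_poly a).
Proof.
rewrite mdegE; apply: deg_lt_prod => j.
rewrite (_ : (fun x => _) = fun x => ((a j)`!%:R)^-1 *
    \prod_(i < a j) ((proj x 0 j)%:~R - i%:R)); last first.
  by apply: funext => x; rewrite /binom_poly mulrC.
apply: deg_lt_scale; rewrite -[X in deg_lt X.+1]card_ord -sum1_card.
apply: deg_lt_prod => i; apply: deg_lt_add; last exact: deg_lt_cst.
have := @deg_lt_coord R G m proj j 0.
by congr deg_lt; apply: funext => x; rewrite subr0.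
Qed.

Lemma lattice_poly_at0 a : lattice_poly a 0 = (a == mnm0)%:R.
Proof.
rewrite /lattice_poly raddf0; have [->|a0] := eqVneq a mnm0.
  by rewrite big1 // => j _; rewrite mnm0E binom_poly0.
have [j aj] : exists j, a j != 0%N.
  apply/existsP; rewrite -negb_forall; apply: contra a0 => /forallP a0.
  by apply/eqP/mnmP => j; rewrite mnm0E; apply/eqP.
by rewrite (bigD1 j) //= mxE binom_poly_at0 (negPf aj) mul0r.
Qed.

Definition ediffs l u := foldr (fun j f => diff (e j) f) u l.

Definition content l : multinom m := foldr (fun j a => mnm_add (mnm1 j) a) mnm0 l.

Lemma content_count l j : content l j = count_mem j l.
Proof. by elim: l => [|i l IHl] /=; rewrite ?mnm0E // mnmDE mnm1E IHl. Qed.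

Lemma mdeg_content l : mdeg (content l) = size l.
Proof. by elim: l => [|i l IHl] /=; rewrite ?mdeg0 // mdegD mdeg1 IHl. Qed.

Lemma content_surj a : exists l, content l = a.
Proof.
move: {2}(mdeg a) (erefl (mdeg a)) => n; elim: n a => [|n IHn] a an.
  by exists [::]; apply/esym/eqP; rewrite -mdeg_eq0 an.
have [j aj] : exists j, (0 < a j)%N.
  apply/existsP; rewrite -[X in is_true X]negbK negb_exists; apply/negP => /forallP a0.
  by move: an; rewrite mdegE big1 // => j _; apply/eqP; have := a0 j; rewrite lt0n negbK.
have ja : lem (mnm1 j) a.
  by apply/mnm_lepP => i; rewrite mnm1E; case: eqP => // <-.
have aE := submK ja.
have [|l lE] := IHn (mnm_sub a (mnm1 j)).
  by move: an; rewrite -{1}aE mdegD mdeg1 addn1 => -[].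
by exists (j :: l); rewrite /= lE addmC.
Qed.

Lemma ediffs_perm l1 l2 u : content l1 = content l2 -> ediffs l1 u = ediffs l2 u.
Proof.
move=> l12; have {l12} : perm_eq l1 l2.
  by apply/allP => j _ /=; rewrite -!content_count l12.
have diffC g h f : diff g (diff h f) = diff h (diff g f).
  by apply: funext => x; rewrite /diff [x + h + g]addrAC; ring.
elim: l1 l2 => [|j l1 IHl] l2 l12; first by move: l12; rewrite perm_sym => /perm_nilP ->.
have /splitPr l2j : j \in l2 by rewrite -(perm_mem l12) mem_head.
case: l2j l12 => s1 s2; rewrite perm_sym perm_catC cat_cons perm_cons perm_catC perm_sym.
move=> /IHl /= ->; elim: s1 => [|i s1 IHs] //=.
by rewrite diffC IHs.
Qed.

Lemma ediffs_sum (I : finType) l (c : I -> R) (F : I -> G -> R) :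
  ediffs l (fun x => \sum_i c i * F i x) = fun x => \sum_i c i * ediffs l (F i) x.
Proof.
elim: l => [|j l IHl] //=; rewrite IHl; apply: funext => x.
by rewrite /diff -sumrB; apply: eq_bigr => i _; rewrite mulrBr.
Qed.

Lemma ediffs_sub l f h : ediffs l (fun x => f x - h x)
  = fun x => ediffs l f x - ediffs l h x.
Proof.
elim: l => [|j l IHl] //=; rewrite IHl; apply: funext => x; rewrite /diff; ring.
Qed.

Lemma deg_lt_ediffs n l u : deg_lt n u -> deg_lt (n - size l) (ediffs l u).
Proof.
elim: l => [|j l IHl] nu /=; first by rewrite subn0.
rewrite subnS; have := IHl nu; case: (n - size l)%N => [|k] /= ku; last exact: ku.
by move=> x; rewrite /diff !ku subrr.
Qed.

Lemma ediffs_lattice_poly l a : ediffs l (lattice_poly a)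
  = if lem (content l) a then lattice_poly (mnm_sub a (content l)) else fun=> 0.
Proof.
elim: l => [|j l IHl] /=.
  have -> : lem mnm0 a by apply/mnm_lepP => i; rewrite mnm0E.
  by congr lattice_poly; apply/mnmP => i; rewrite mnmBE mnm0E subn0.
rewrite IHl; have [la|nla] := boolP (lem (content l) a); last first.
  rewrite (negPf (_ : ~~ lem (mnm_add _ _) a)); last first.
    apply: contra nla => /mnm_lepP la; apply/mnm_lepP => i.
    by apply: leq_trans (la i); rewrite mnmDE leq_addl.
  by apply: funext => x; rewrite /diff subrr.
rewrite diff_lattice_poly; congr (if _ then lattice_poly _ else _).
  apply/mnm_lepP/mnm_lepP => la' i; have := la' i; have := mnm_lepP la i;
    rewrite ?mnmDE ?mnmBE; lia.
by apply/mnmP => i; rewrite !mnmBE mnmDE; lia.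
Qed.

(** Duality behind Newton interpolation: iterated differences at 0 read off the coefficients in the
    basis [lattice_poly]. *)
Lemma ediffs_lattice_poly_at0 l a : ediffs l (lattice_poly a) 0 = (a == content l)%:R.
Proof.
rewrite ediffs_lattice_poly; case: ifPn => [la|nla].
  rewrite lattice_poly_at0; congr (nat_of_bool _)%:R.
  apply/eqP/eqP => [a0|->]; last by apply/mnmP => i; rewrite mnmBE mnm0E subnn.
  by rewrite -[LHS](submK la) a0 add0m.
by case: eqP nla => // ->; case/negP; apply/mnm_lepP.
Qed.

Variable q : nat.
Hypothesis q_gt0 : (0 < q)%N.
Hypothesis proj_ker : forall t, proj t = 0 -> t *+ q = 0.

(** By induction on the degree the differences along the [e j] vanish, so [h] is constant along the
    lattice section; [diff_torsion] covers the remaining torsion part. *)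
Lemma deg_lt_vanish n h : deg_lt n h -> (forall l, ediffs l h 0 = 0) ->
  forall x, h x = 0.
Proof.
elim: n h => [|n IHn] h // nh h0 x.
have he j y : h (y + e j) = h y.
  have hj : forall z, diff (e j) h z = 0.
    apply: IHn => // l; have := h0 (rcons l j).
    by rewrite /ediffs foldr_rcons.
  by apply/eqP; rewrite -subr_eq0; apply/eqP; exact: hj.
have hen j y k : h (y + e j *+ k) = h y.
  by elim: k => [|k IHk]; rewrite ?addr0 // mulrSr addrA he.
have hez j y (z : int) : h (y + e j *~ z) = h y.
  case: z => k; first exact: hen.
  by rewrite NegzE mulrNz; have := hen j (y - e j *+ k.+1) k.+1; rewrite subrK => ->.
have hsec y : h (y + section_of e (proj x)) = h y.
  rewrite /section_of; elim: (index_enum _) y => [|j s IHs] y.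
    by rewrite big_nil addr0.
  by rewrite big_cons addrA IHs hez.
have := h0 [::]; rewrite /= -(hsec 0) add0r => <-.
have : diff (x - section_of e (proj x)) h (section_of e (proj x)) = 0.
  apply: (diff_torsion q_gt0 _ nh); apply: proj_ker.
  by rewrite raddfB section_ofK // subrr.
by rewrite /diff [section_of _ _ + _]addrC subrK => /eqP; rewrite subr_eq0 => /eqP.
Qed.

End LatticePolynomials.

(** * Discrete harmonic polynomials in the Newton basis *)

Section HarmonicLatticePolynomials.
Variables (R : realType) (G : zmodType) (r m k : nat) (S : (r + r).-tuple G).
Local Notation N := (r + r)%N.
Hypothesis r_gt0 : (0 < r)%N.
Hypothesis S_sym : forall i : 'I_r, tnth S (rshift r i) = - tnth S (lshift r i).
Hypothesis S_gen : forall x, exists w, x = wsum S w.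
Variables (proj : {additive G -> 'rV[int]_m}) (e : 'I_m -> G) (q : nat).
Hypothesis proj_e : forall j, proj (e j) = delta_mx 0 j.
Hypothesis q_gt0 : (0 < q)%N.
Hypothesis proj_ker : forall t, proj t = 0 -> t *+ q = 0.
Implicit Types (u : G -> R) (x : G) (l : seq 'I_m) (a b : multinom m).

Local Notation I := (bmultinom m k.+1).
Local Notation two i := (mnm_add (mnm1 i) (mnm1 i)).
Local Notation B := (fun i : I => lattice_poly R proj i).

Lemma ediffs_newton (c : I -> R) (i : I) l : content l = i ->
  ediffs e l (fun x => \sum_j c j * B j x) 0 = c i.
Proof.
move=> li; rewrite ediffs_sum (bigD1 i) //= ediffs_lattice_poly_at0 // li eqxx.
rewrite mulr1 big1 ?addr0 // => j ji.
by rewrite ediffs_lattice_poly_at0 // li -bmeqP (negPf ji) mulr0.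
Qed.

(** The coefficients are iterated differences at 0. The remainder then has no nonzero difference at
    0: short ones cancel by duality, long ones vanish by degree. *)
Lemma newton_expansion u : deg_lt k.+1 u ->
  exists c : I -> R, forall x, u x = \sum_i c i * B i x.
Proof.
move=> ku; have [w wE] := choice (@content_surj m).
pose c (i : I) := ediffs e (w i) u 0; exists c => x.
apply/eqP; rewrite -subr_eq0; apply/eqP; move: x.
have kB : deg_lt k.+1 (fun x => \sum_i c i * B i x).
  apply: deg_lt_sum => i; apply: deg_lt_scale.
  by apply: deg_lt_le (deg_lt_lattice_poly _ _ _); apply: bmdeg.
have kh : deg_lt k.+1 (fun x => u x - \sum_i c i * B i x).
  rewrite (_ : (fun x => _) = fun x => -1 * (\sum_i c i * B i x) + u x).
    exact: deg_lt_lin.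
  by apply: funext => x; ring.
apply: (deg_lt_vanish proj_e q_gt0 proj_ker kh) => l; rewrite ediffs_sub.
have [lk|kl] := ltnP (mdeg (content l)) k.+1.
  rewrite (ediffs_newton c (erefl : content l = BMultinom lk)) /c.
  by rewrite (ediffs_perm e u (wE (content l))) subrr.
have sz : (k.+1 - size l = 0)%N by apply/eqP; rewrite subn_eq0 -mdeg_content.
have := deg_lt_ediffs e l ku; have := deg_lt_ediffs e l kB; rewrite sz => h1 h2.
by rewrite h1 h2 subrr.
Qed.

(** The Laplacian of the basis polynomial with exponent [a], evaluated at 0; these are the
    coefficients of the operator in Newton coordinates. *)
Definition step_symbol a : R :=
  \sum_(s < N) (lattice_poly R proj a (tnth S s) - lattice_poly R proj a 0).

(** Differences commute with averaging, so the equation at [b] is a difference at 0 of [avg u - u].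
    All of them together suffice by [deg_lt_vanish]. *)
Lemma harmonic_newton (c : I -> R) : harmonic S (fun x => \sum_i c i * B i x) <->
  forall b, \sum_(i : I | lem b i) c i * step_symbol (mnm_sub i b) = 0.
Proof.
set u := fun x => _; pose Lu x : R := avg S u x - u x.
have N0 : N%:R != 0 :> R by rewrite pnatr_eq0 -lt0n addn_gt0 r_gt0.
have ediffs_avg l f : ediffs e l (avg S f) = avg S (ediffs e l f).
  elim: l => [|j l IHl] //=; rewrite IHl; apply: funext => x; rewrite /diff /avg.
  rewrite -mulrBr -sumrB; congr (_ * _); apply: eq_bigr => s _.
  by rewrite addrAC.
have LE l : ediffs e l Lu 0 = N%:R^-1 *
    \sum_(i : I | lem (content l) i) c i * step_symbol (mnm_sub i (content l)).
  rewrite /Lu ediffs_sub ediffs_avg avg_sub //; congr (_ * _).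
  rewrite [RHS]big_mkcond /= /step_symbol /diff ediffs_sum.
  transitivity (\sum_(s < N) \sum_(i : I) c i *
      (ediffs e l (B i) (tnth S s) - ediffs e l (B i) 0)).
    apply: eq_bigr => s _; rewrite add0r -sumrB.
    by apply: eq_bigr => i _; rewrite mulrBr.
  rewrite exchange_big; apply: eq_bigr => i _; rewrite -mulr_sumr ediffs_lattice_poly //.
  by case: ifP => // _; rewrite big1 ?mulr0 // => s _; rewrite subrr.
have kLu : deg_lt k.+1 Lu.
  have kB : deg_lt k.+1 u.
    apply: deg_lt_sum => i; apply: deg_lt_scale.
    by apply: deg_lt_le (deg_lt_lattice_poly _ _ _); apply: bmdeg.
  by apply: deg_lt_avg => //; apply/deg_ltS/deg_ltS.
split=> [hu b|cb].
  have [l <-] := content_surj b.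
  have Lu0 : Lu = fun=> 0 by apply: funext => x; rewrite /Lu hu subrr.
  have := LE l; rewrite Lu0.
  have -> : ediffs e l (fun=> 0) 0 = 0 :> R.
    have := @deg_lt_ediffs R G m e 0 l (fun=> 0) (fun=> erefl).
    by rewrite sub0n => ->.
  by move/esym/eqP; rewrite mulf_eq0 invr_eq0 (negPf N0) => /eqP.
move=> x; apply/eqP; rewrite -subr_eq0; apply/eqP.
apply: (deg_lt_vanish proj_e q_gt0 proj_ker kLu) => l.
by rewrite LE cb mulr0.
Qed.

(** Constants do not change along a step, and linear terms cancel because the generators sum to
    0. *)
Lemma step_symbol_low a : (mdeg a < 2)%N -> step_symbol a = 0.
Proof.
rewrite ltnS leq_eqVlt ltnS leqn0 mdeg_eq1 mdeg_eq0.
move=> /orP[/existsP[j /eqP ->]|/eqP ->]; last first.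
  rewrite /step_symbol big1 // => s _; rewrite /lattice_poly.
  by rewrite !big1 ?subrr // => j _; rewrite mnm0E binom_poly0.
have B1 x : lattice_poly R proj (mnm1 j) x = (proj x 0 j)%:~R :> R.
  rewrite /lattice_poly (bigD1 j) //= mnm1E eqxx binom_poly1 big1 ?mulr1 // => i ij.
  by rewrite mnm1E eq_sym (negPf ij) binom_poly0.
rewrite /step_symbol; under eq_bigr do rewrite !B1 raddf0 mxE subr0.
by rewrite -rmorph_sum /= -summxE -raddf_sum sum_S0 // raddf0 mxE.
Qed.

(** After the linear terms cancel, half a sum of squares of [j]-coordinates remains. If it vanished,
    no word could reach [e j]. *)
Lemma step_symbol_two j : step_symbol (two j) != 0.
Proof.
have B2 x : lattice_poly R proj (two j) x
    = ((proj x 0 j)%:~R ^+ 2 - (proj x 0 j)%:~R) / 2 :> R.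
  rewrite /lattice_poly (bigD1 j) //= mnmDE mnm1E eqxx binom_poly2.
  rewrite big1 ?mulr1 // => i ij.
  by rewrite mnmDE mnm1E eq_sym (negPf ij) binom_poly0.
have sum0 : \sum_(s < N) (proj (tnth S s) 0 j)%:~R = 0 :> R.
  by rewrite -rmorph_sum /= -summxE -raddf_sum sum_S0 // raddf0 mxE.
rewrite /step_symbol; under eq_bigr do rewrite !B2 raddf0 mxE expr0n subr0 mul0r subr0.
rewrite -mulr_suml sumrB sum0 subr0 mulf_eq0 invr_eq0 pnatr_eq0 orbF.
rewrite psumr_eq0; last by move=> s _; apply: sqr_ge0.
apply/negP => /allP S0.
have S0' s : proj (tnth S s) 0 j = 0.
  by have := S0 s (mem_index_enum _); rewrite /= sqrf_eq0 intr_eq0 => /eqP.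
have [w ej] := S_gen (e j).
have : proj (e j) 0 j = 0.
  rewrite ej /wsum raddf_sum summxE big1 // => s _; exact: S0'.
by rewrite proj_e mxE !eqxx.
Qed.

Lemma harmonic_dim (i0 : 'I_m) :
  has_dim ([set u | harmonic S u /\ deg_lt k.+1 u] : set (G -> R^o))
    #|[pred i : I | (i i0 <= 1)%N]|.
Proof.
have combE (c : I -> R) : \sum_i c i *: (B i : G -> R^o)
    = (fun x => \sum_i c i * B i x) :> (G -> R^o).
  by rewrite fct_sumE.
apply: (@kernel_dim R (G -> R^o) m k i0 step_symbol B).
- exact: step_symbol_low.
- exact: step_symbol_two.
- move=> c; rewrite combE => c0 i; have [l li] := content_surj i.
  rewrite -(ediffs_newton c li) c0.
  have := @deg_lt_ediffs R G m e 0 l (fun=> 0) (fun=> erefl).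
  by rewrite sub0n => ->.
move=> u; split=> [[hu ku]|[c -> cb]].
  have [c uE] := newton_expansion ku.
  have {}uE : u = (fun x => \sum_i c i * B i x) by apply: funext.
  exists c; first by rewrite combE.
  by apply/harmonic_newton; rewrite -uE.
rewrite combE; split; first exact/harmonic_newton.
apply: deg_lt_sum => i; apply: deg_lt_scale.
by apply: deg_lt_le (deg_lt_lattice_poly _ _ _); apply: bmdeg.
Qed.

End HarmonicLatticePolynomials.

(** * Growth classes *)

Section GrowthClasses.
Variables (R : realType) (G : zmodType) (r m : nat) (S : (r + r).-tuple G).
Local Notation N := (r + r)%N.
Hypothesis r_gt0 : (0 < r)%N.
Hypothesis S_sym : forall i : 'I_r, tnth S (rshift r i) = - tnth S (lshift r i).
Hypothesis S_gen : forall x, exists w, x = wsum S w.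
Variables (proj : {additive G -> 'rV[int]_m}) (e : 'I_m -> G) (q : nat).
Hypothesis proj_e : forall j, proj (e j) = delta_mx 0 j.
Hypothesis q_gt0 : (0 < q)%N.
Hypothesis proj_ker : forall t, proj t = 0 -> t *+ q = 0.
Implicit Types (u : G -> R) (x : G).
Variables (d : R) (x0 : G) (k : nat).
Hypothesis d_ge0 : 0 <= d.
Hypothesis k_le : k%:R <= d.
Hypothesis lt_k : d < k.+1%:R.

Local Notation rho x := (word_metric S x0 x).+1.

Lemma laplacianP u : (forall x, laplacian S u x = 0) <-> harmonic S u.
Proof.
have lapE x : laplacian S u x = N%:R * (avg S u x - u x).
  rewrite avg_sub // mulVKf ?pnatr_eq0 -?lt0n ?addn_gt0 ?r_gt0 //.
  by rewrite /laplacian big_tuple.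
split=> hu x; last by rewrite lapE hu subrr mulr0.
have /eqP := hu x; rewrite lapE mulf_eq0 pnatr_eq0 gtn_eqF ?addn_gt0 ?r_gt0 //=.
by rewrite subr_eq0 => /eqP.
Qed.

(** Sum the differences along a shortest word from [x0] to [x]: the length contributes one more
    power of the distance. *)
Lemma deg_lt_growth n u : deg_lt n.+1 u ->
  exists2 C : R, 0 <= C & forall x, `|u x| <= C * (rho x)%:R ^+ n.
Proof.
elim: n u => [|n IHn] u nu.
  exists `|u x0| => // x; rewrite mulr1; have := nu (x - x0) x0.
  by rewrite /diff addrCA subrr addr0 => /eqP; rewrite subr_eq0 => /eqP ->.
have [i|C CE] := @choice 'I_N R (fun i C => 0 <= C /\
    forall x, `|diff (tnth S i) u x| <= C * (rho x)%:R ^+ n).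
  by have [C C0 uC] := IHn _ (nu (tnth S i)); exists C.
pose D := \sum_i C i.
have D0 : 0 <= D by apply: sumr_ge0 => i _; have [] := CE i.
have uD i x : `|diff (tnth S i) u x| <= D * (rho x)%:R ^+ n.
  have [_ /(_ x)/le_trans] := CE i; apply; apply: ler_wpM2r; first exact: exprn_ge0.
  by rewrite /D (bigD1 i) //= lerDl; apply: sumr_ge0 => j _; have [] := CE j.
exists (`|u x0| + D); first exact: addr_ge0.
move=> x; have [w szw xw] := word_metric_word S_gen x0 x.
have walk : `|u (x0 + wsum S w)|
    <= `|u x0| + (size w)%:R * (D * (size w).+1%:R ^+ n).
  elim: w {szw xw} => [|i w IHw]; first by rewrite /wsum big_nil addr0 mul0r addr0.
  have -> : u (x0 + wsum S (i :: w))
      = u (x0 + wsum S w) + diff (tnth S i) u (x0 + wsum S w).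
    by rewrite wsum_cons /diff [tnth S i + _]addrC addrA; ring.
  apply: (le_trans (ler_normD _ _)).
  rewrite [size (i :: w)]/= -[(size w).+1%:R in leRHS]natr1 mulrDl mul1r addrA.
  have mono (a b : nat) : (a <= b)%N -> D * a%:R ^+ n <= D * b%:R ^+ n.
    by move=> ab; apply: ler_wpM2l => //; rewrite lerXn2r ?nnegrE // ler_nat.
  apply: lerD.
    apply: (le_trans IHw); rewrite lerD2l; apply: ler_wpM2l => //.
    exact: mono.
  apply: (le_trans (uD i _)); apply: mono.
  by rewrite ltnS (leq_trans (word_metric_le _ _ _)).
rewrite [in leLHS]xw; apply: (le_trans walk); rewrite -szw mulrDl; apply: lerD.
  by rewrite ler_peMr // exprn_ege1 // ler1n.
rewrite mulrCA; apply: ler_wpM2l => //.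
by rewrite exprS; apply: ler_wpM2r; rewrite ?exprn_ge0 // ler_nat.
Qed.

Let E : set (G -> R^o) := [set u | harmonic S u /\ deg_lt k.+1 u].

Lemma lower_bounded_sub u C : (forall x, laplacian S u x = 0) ->
  (forall x, - C * growth S d x0 x <= u x) -> E u.
Proof.
move=> /laplacianP hu ulo; split=> //.
(* [C] may be negative, while comparing [growth] with the integer power [k.+1] needs a nonnegative
   constant. *)
have [x|C' [D [C'0 uD]]] := @one_sided_growth R G r S r_gt0 S_sym S_gen x0 u `|C| k.+1 hu.
  apply: le_trans (ulo x); rewrite !mulNr lerN2.
  apply: (@le_trans _ _ (`|C| * growth S d x0 x)).
    by apply: ler_wpM2r; rewrite ?ler_norm // growth_ge0.
  by apply: ler_wpM2l => //; apply: growth_le_pow => //; apply: ltW.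
have := harmonic_polynomial r_gt0 S_gen hu uD.
(* The crude degree is lowered one unit at a time, as long as it exceeds [k] and hence [d]. *)
elim: (3 * D + 1)%N => [|n IHn] nu; first exact: (deg_lt_le (leq0n _) nu).
have [nk|kn] := leqP n k; first by apply: (deg_lt_le _ nu); rewrite ltnS.
apply: IHn; apply: (one_sided_degree r_gt0 S_sym S_gen proj_e q_gt0 proj_ker _ hu nu _ ulo) => //.
by apply: (lt_le_trans lt_k); rewrite ler_nat.
Qed.

Lemma H_polynomials : H S d x0 = E.
Proof.
apply/seteqP; split=> u /=.
  move=> [hu [C uC]]; apply: (lower_bounded_sub (C := C)) => // x.
  by have := uC x; rewrite ler_norml mulNr => /andP[].
move=> [hu ku]; split; first exact/laplacianP.
have [C C0 uC] := deg_lt_growth ku; exists C => x.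
apply: (le_trans (uC x)); apply: ler_wpM2l => //.
exact: growth_ge_pow.
Qed.

(** The spanning functions already lie in the linear space [E], so taking the span adds nothing;
    conversely a two-sided bound is in particular one-sided. *)
Lemma HM_polynomials : HM S d x0 = E.
Proof.
apply/seteqP; split=> u /=.
  move=> [n [c [f [fE ->]]]]; elim/big_ind: _ => [|v w|i _].
  - by split; [move=> x; rewrite -[0]/(fun=> 0 : R^o) avg_cst | apply: deg_lt0].
  - move=> [hv kv] [hw kw]; have -> : v + w = (fun x => 1 * v x + w x) :> (G -> R^o).
      by apply: funext => x; rewrite mul1r.
    by split; [apply: harmonic_lin | apply: deg_lt_lin].
  have [hf [C fC]] := fE i; have [hE kE] := lower_bounded_sub hf fC.
  have -> : c i *: f i = (fun x => c i * f i x + 0) :> (G -> R^o).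
    by apply: funext => x; rewrite addr0.
  by split; [apply: harmonic_lin => // x; rewrite avg_cst | apply/deg_lt_lin/deg_lt0].
rewrite -H_polynomials => -[hu [C uC]].
exists 1%N, (fun=> 1), (fun=> u); split; last by rewrite big_ord1 scale1r.
move=> _; split=> //; exists C => x.
by have := uC x; rewrite ler_norml mulNr => /andP[].
Qed.

End GrowthClasses.

(** * The lattice quotient of the direct sum *)

Section LatticeProjection.
Variables (G G1 G2 : zmodType) (m : nat).
Variables (j1 : {additive G1 -> G}) (j2 : {additive G2 -> G}).
Variables (split_sum : G -> G1 * G2).
Hypothesis sumK : cancel (fun g : G1 * G2 => j1 g.1 + j2 g.2) split_sum.
Hypothesis splitK : cancel split_sum (fun g : G1 * G2 => j1 g.1 + j2 g.2).
Variable f1 : {additive G1 -> 'rV[int]_m}.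

Definition lattice_proj (g : G) : 'rV[int]_m := f1 (split_sum g).1.

Lemma lattice_proj_sum g1 g2 : lattice_proj (j1 g1 + j2 g2) = f1 g1.
Proof. by rewrite /lattice_proj (sumK (g1, g2)). Qed.

Lemma lattice_proj_is_additive : Algebra.zmod_morphism lattice_proj.
Proof.
move=> x y; rewrite -[in LHS](splitK x) -[in LHS](splitK y) opprD addrACA -!raddfB.
by rewrite lattice_proj_sum raddfB.
Qed.

HB.instance Definition _ :=
  GRing.isZmodMorphism.Build G 'rV[int]_m lattice_proj lattice_proj_is_additive.

Lemma lattice_proj_exists : exists proj : {additive G -> 'rV[int]_m},
  forall g1 g2, proj (j1 g1 + j2 g2) = f1 g1.
Proof. by exists lattice_proj; apply: lattice_proj_sum. Qed.

End LatticeProjection.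

(** A negative coefficient is realized by repeating the index of the opposite generator. *)
Lemma int_span_words (G : zmodType) (r : nat) (S : (r + r).-tuple G) :
  (forall i : 'I_r, tnth S (rshift r i) = - tnth S (lshift r i)) ->
  forall x, inIntSpan S x -> exists w, x = wsum S w.
Proof.
move=> S_sym x [a ->]; elim/big_ind: _ => [|x1 x2 [w1 ->] [w2 ->]|i _].
- by exists [::]; rewrite /wsum big_nil.
- by exists (w1 ++ w2); rewrite wsum_cat.
rewrite -tnth_nth.
have wsum_nseq j n : wsum S (nseq n j) = tnth S j *+ n.
  by rewrite /wsum big_nseq iter_addr_0.
have [i' Si'] : exists i', tnth S i' = - tnth S i.
  case: (split_ordP i) => j ->; first by exists (rshift r j); rewrite S_sym.
  by exists (lshift r j); rewrite S_sym opprK.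
case: (a i) => n; first by exists (nseq n i); rewrite wsum_nseq.
by exists (nseq n.+1 i'); rewrite wsum_nseq Si' NegzE mulrNz mulNrn.
Qed.

Theorem theorem1p4 (R : realType) (m l : nat) (hm : (1 <= m)%N)
  (p a : 'I_l -> nat)
  (hp : forall i : 'I_l, prime (p i)) (ha : forall i : 'I_l, (0 < a i)%N)
  (G G1 G2 : zmodType)
  (j1 : {additive G1 -> G}) (j2 : {additive G2 -> G})
  (hG : bijective (fun g : G1 * G2 => j1 g.1 + j2 g.2))
  (f1 : {additive G1 -> 'rV[int]_m}) (hf1 : bijective f1)
  (f2 : forall i : 'I_l, {additive G2 -> 'Z_(p i ^ a i)})
  (hf2 : bijective (fun (x : G2) (i : 'I_l) => f2 i x))
  (r : nat) (S : (r + r).-tuple G)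
  (hSsym : forall i : 'I_r, tnth S (rshift r i) = - tnth S (lshift r i))
  (hSgen : forall x : G, inIntSpan S x)
  (x0 : G) (d : R) (hd : 0 <= d) :
  exists n : nat,
    [/\ has_dim (HM S d x0) n,
        has_dim (H S d x0) n &
        has_dim (HP R m `|Num.floor d|%N) n].
Proof.
have S_gen x : exists w, x = wsum S w by exact: int_span_words.
have [psi phiK psiK] := hG; have [g1 f1K g1K] := hf1.
have [proj projE] := lattice_proj_exists phiK psiK f1.
pose e j := j1 (g1 (delta_mx 0 j)).
have proj_e j : proj (e j) = delta_mx 0 j.
  by rewrite -[e j]addr0 -(raddf0 j2) projE g1K.
(* A common multiple of the orders of the cyclic factors, hence an exponent for [G2]. *)
pose q := (\prod_i p i ^ a i)%N.
(* The ring ['Z_n] has characteristic [n] only for [n > 1]; this uses [0 < a i]. *)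
have pa_gt1 i : (1 < p i ^ a i)%N by rewrite -[1%N](expn0 (p i)) ltn_exp2l ?ha ?prime_gt1.
have q_gt0 : (0 < q)%N by apply: prodn_gt0 => i; apply: ltnW.
have proj_ker t : proj t = 0 -> t *+ q = 0.
  rewrite -(psiK t) /= projE => t0.
  have -> : (psi t).1 = 0 by apply: (can_inj f1K); rewrite t0 raddf0.
  rewrite raddf0 add0r -raddfMn /=.
  suff -> : (psi t).2 *+ q = 0 by rewrite raddf0.
  apply: (bij_inj hf2); apply: functional_extensionality_dep => i.
  rewrite raddf0 raddfMn /q (bigD1 i) //= mulrnA -[f2 i _ *+ _]mulr_natr.
  by rewrite pchar_Zp // mulr0 mul0rn.
(* Without generators the group would be trivial, contradicting [1 <= m]. *)
have r_gt0 : (0 < r)%N.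
  rewrite lt0n; apply/negP => /eqP r0.
  have := proj_e (Ordinal hm); have [w ->] := S_gen (e (Ordinal hm)).
  case: w => [|i w]; last by case: i => i; lia.
  rewrite /wsum big_nil raddf0 => /matrixP/(_ 0 (Ordinal hm)) /eqP.
  by rewrite !mxE !eqxx eq_sym oner_eq0.
set k := `|Num.floor d|%N.
have kE : k%:R = (Num.floor d)%:~R :> R.
  by rewrite /k natr_absz ger0_norm // Num.Theory.floor_ge0.
have k_le : k%:R <= d by rewrite kE Num.Theory.floor_le.
have lt_k : d < k.+1%:R by rewrite -natr1 kE -[1]/(1%:~R) -intrD Num.Theory.floorD1_gt.
(* Exponents of degree at most [k] with first entry 0 or 1: these two cases account for the two
   binomial coefficients in the classical dimension formula. *)
exists #|[pred i : bmultinom m k.+1 | (i (Ordinal hm) <= 1)%N]|.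
rewrite (HM_polynomials r_gt0 hSsym S_gen proj_e q_gt0 proj_ker x0 hd k_le lt_k).
rewrite (H_polynomials r_gt0 hSsym S_gen proj_e q_gt0 proj_ker x0 hd k_le lt_k).
have dimE := harmonic_dim R k r_gt0 hSsym S_gen proj_e q_gt0 proj_ker (Ordinal hm).
by split; [exact: dimE | exact: dimE | exact: HP_dim].
Qed.
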